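(* Almost surely, there is at most one function $\widehat r^0\in\mathcal C^0$ such that, with $\tau_L,\tau_R,X_L,X_R,Y_L,Y_R$ defined from $\widehat r^0$ and $X$ as in the context, and with $$H_R(t):=\int_{\tau_R}^t\int_{\tau_R}^u\widehat r^0(v)\,dv\,du,\qquad H_L(t):=\int_t^{\tau_L}\int_u^{\tau_L}\widehat r^0(v)\,dv\,du\qquad(t\in\mathbb R),$$ the following three conditions hold: 1. $(H_R-Y_R)(0)=(H_L-Y_L)(0)$; 2. $(H_R-Y_R)(t)\le0$ for all $t\ge0$, and $(H_L-Y_L)(t)\le0$ for all $t\le0$; 3. $\displaystyle\int_{(-\infty,0]}(H_L-Y_L)\,d(\widehat r^0)'=0=\int_{[0,\infty)}(H_R-Y_R)\,d(\widehat r^0)'$.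
   Context: $W$ is a standard two-sided Brownian motion started from $0$, and $dX(t)=-12t^2\,dt+dW(t)$, i.e. $X(t)=W(t)-4t^3$, $t\in\mathbb R$. $\mathcal C$ is the set of concave, closed (upper semicontinuous), proper functions $\mathbb R\to[-\infty,\infty)$, and $\mathcal C^0:=\{r\in\mathcal C:r(0)=0\}$; the candidate functions $\widehat r^0$ are real-valued on $\mathbb R$ (so that the processes $H_R,H_L$ and the measure $d(\widehat r^0)'$ are defined on all of $\mathbb R$). For such $\widehat r^0$, the knot set $\widehat S^0$ is the complement of $\{t\in\mathbb R:(\widehat r^0)''(t)=0\}$ (so $t\in\widehat S^0$ iff the second derivative fails to exist at $t$ or is nonzero). Put $$\tau_R:=\inf(\widehat S^0\cap[0,\infty)),\qquad\tau_L:=\sup(\widehat S^0\cap(-\infty,0]),$$ which are taken to be well defined and finite, and for $t\in\mathbb R$ $$X_R(t):=X(t)-X(\tau_R),\quad X_L(t):=X(\tau_L)-X(t),\quad Y_R(t):=\int_{\tau_R}^tX_R(u)\,du,\quad Y_L(t):=\int_t^{\tau_L}X_L(u)\,du.$$ $(\widehat r^0)'$ is the (one-sided) derivative of $\widehat r^0$, a nonincreasing function, and $d(\widehat r^0)'$ is the corresponding (nonpositive) Lebesgue–Stieltjes measure. *)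

(* Defs.v *)
From HB Require Import structures.
From mathcomp Require Import all_boot all_order all_algebra.
From mathcomp Require Import ring lra.
From mathcomp Require Import all_classical all_reals all_analysis.

Set Implicit Arguments.
Unset Strict Implicit.
Unset Printing Implicit Defensive.

Import Order.TTheory GRing.Theory Num.Theory.
Import numFieldNormedType.Exports.

Local Open Scope classical_set_scope.
Local Open Scope ring_scope.

(* The law of an increment is only prescribed on measurable sets, because
   [normal_prob] has no meaning elsewhere.  The second argument of
   [normal_prob] is a standard deviation. *)
Record two_sided_brownian_motion (d : measure_display) (T : measurableType d)
    (R : realType) (P : probability T R) (W : R -> {RV P >-> R}) : Prop := {
  bm_start : {ae P, forall w, W 0 w = 0} ;
  bm_gaussian_increments : forall s t : R, s < t ->
    forall B : set R, measurable B ->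
    P [set w | B (W t w - W s w)] = normal_prob 0 (Num.sqrt (t - s)) B ;
  bm_independent_increments : forall (n : nat) (t : nat -> R) (B : nat -> set R),
    {homo t : i j / (i <= j)%N >-> i <= j} ->
    (forall i, measurable (B i)) ->
    P (\bigcap_(i < n) [set w | B i (W (t i.+1) w - W (t i) w)]) =
    (\prod_(i < n) P [set w | B i (W (t i.+1) w - W (t i) w)%R])%E ;
  bm_continuous_paths : {ae P, forall w, continuous (fun t : R => W t w : R)}
}.

Section concave_functions.
Context {R : realType}.
Implicit Types (f : R -> \bar R) (r : R -> R).

(* No indeterminate sum occurs for functions that never take the value +oo;
   0 * -oo = 0 makes the cases p = 0 and p = 1 trivial. *)
Definition econcave f := forall p x y : R, 0 <= p <= 1 ->
  (p%:E * f x + (1 - p)%:E * f y <= f (p * x + (1 - p) * y)%R)%E.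

Definition upper_semicontinuous f := lower_semicontinuous (fun x => - f x)%E.

Definition proper_function f :=
  (forall x, f x < +oo)%E /\ (exists x, -oo < f x)%E.

Definition classC f :=
  [/\ econcave f, upper_semicontinuous f & proper_function f].

Definition classC0 f := classC f /\ f 0 = 0%E.

(* [derive1] has a junk value where the derivative does not exist, hence the
   explicit differentiability of r around t and of r' at t. *)
Definition second_derivative_zero r (t : R) :=
  [/\ \forall u \near t, derivable r u 1,
      derivable (derive1 r) t 1 & derive1 (derive1 r) t = 0].

Definition knots r : set R := ~` [set t | second_derivative_zero r t].

Definition tauR r : R := inf (knots r `&` `[0, +oo[).
Definition tauL r : R := sup (knots r `&` `]-oo, 0]).

Definition rderiv r (t : R) : R :=
  lim ((fun h : R => h^-1 * (r (t + h) - r t)) @ 0^'+).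

Definition is_cumulative (F : R -> R) :=
  nondecreasing F /\ right_continuous F.

Definition cumulative_of (F : R -> R) (h : is_cumulative F) : cumulative R R :=
  HB.pack_for (cumulative R R) F
    (@isCumulative.Build R _ R F (proj1 h) (proj2 h)).

Definition stieltjes (F : R -> R) : {measure set (measurableTypeR R) -> \bar R} :=
  match pselect (is_cumulative F) with
  | left h => lebesgue_stieltjes_measure (cumulative_of h)
  | right _ => mzero
  end.

Lemma stieltjes_itv (F : R -> R) (a b : R) : is_cumulative F -> a <= b ->
  stieltjes F `]a, b]%classic = (F b - F a)%:E.
Proof.
move=> hF ab; rewrite /stieltjes; case: pselect => // h.
rewrite -[LHS]/(lebesgue_stieltjes_measure (cumulative_of h) `]a, b]%classic).
rewrite /lebesgue_stieltjes_measure /measure_extension measurable_mu_extE; last first.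
  exact: is_ocitv.
exact: (wlength_itv_bnd F false false ab).
Qed.

(* Integral over A against the nonpositive measure dr', for r concave: -r' is
   nondecreasing, and dr' is minus its Lebesgue-Stieltjes measure.  By
   [is_cumulative_rderiv] below, the default of [stieltjes] is never used. *)
Definition integral_dderiv r (A : set R) (g : R -> R) : \bar R :=
  (- \int[stieltjes (fun t => - rderiv r t)%R]_(t in A) (g t)%:E)%E.

End concave_functions.

Section processes.
Context {R : realType}.
Implicit Types (X r f : R -> R).

(* \int_a^b f, with the usual sign change when b < a. *)
Definition oint (a b : R) f : R :=
  if a <= b then \int[lebesgue_measure]_(x in `[a, b]) f x
  else - \int[lebesgue_measure]_(x in `[b, a]) f x.

Definition XR X r (t : R) : R := X t - X (tauR r).
Definition XL X r (t : R) : R := X (tauL r) - X t.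
Definition YR X r (t : R) : R := oint (tauR r) t (XR X r).
Definition YL X r (t : R) : R := oint t (tauL r) (XL X r).
Definition HR r (t : R) : R := oint (tauR r) t (fun u => oint (tauR r) u r).
Definition HL r (t : R) : R := oint t (tauL r) (fun u => oint u (tauL r) r).

(* X is one sample path of the driving process.  The two nonemptiness
   conditions express that tauL and tauR are well defined and finite. *)
Record characterization X r : Prop := {
  char_C0 : classC0 (fun t => (r t)%:E) ;
  char_tauR : knots r `&` `[0, +oo[ !=set0 ;
  char_tauL : knots r `&` `]-oo, 0] !=set0 ;
  char_eq0 : HR r 0 - YR X r 0 = HL r 0 - YL X r 0 ;
  char_leR : forall t : R, 0 <= t -> HR r t - YR X r t <= 0 ;
  char_leL : forall t : R, t <= 0 -> HL r t - YL X r t <= 0 ;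
  char_intL : integral_dderiv r `]-oo, 0] (fun t => HL r t - YL X r t) = 0%E ;
  char_intR : integral_dderiv r `[0, +oo[ (fun t => HR r t - YR X r t) = 0%E
}.

End processes.

Section rderiv_concave.
Context {R : realType}.
Variable r : R -> R.
Hypothesis r_concave : econcave (fun t => (r t)%:E).

Let slope (x y : R) := (y - x)^-1 * (r y - r x).

Let three (x y z : R) : x < y -> y < z ->
  (z - y) * r x + (y - x) * r z <= (z - x) * r y.
Proof.
move=> xy yz; have zx : 0 < z - x by rewrite subr_gt0 (lt_trans xy).
have p01 : 0 <= (z - y) / (z - x) <= 1.
  apply/andP; split.
    by apply: divr_ge0; [rewrite subr_ge0 ltW|exact: ltW].
  by rewrite ler_pdivrMr// mul1r lerD2l lerN2 ltW.
have := r_concave x z p01; rewrite -!EFinM -EFinD lee_fin.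
have -> : 1 - (z - y) / (z - x) = (y - x) / (z - x).
  by field; rewrite gt_eqF.
have -> : (z - y) / (z - x) * x + (y - x) / (z - x) * z = y.
  by field; rewrite gt_eqF.
move=> H.
have := ler_wpM2l (ltW zx) H.
suff -> : (z - x) * ((z - y) / (z - x) * r x + (y - x) / (z - x) * r z) =
  (z - y) * r x + (y - x) * r z by [].
by field; rewrite gt_eqF.
Qed.

Let slope_le1 (x y z : R) : x < y -> y < z -> slope x z <= slope x y.
Proof.
move=> xy yz; have xz := lt_trans xy yz; have H := three xy yz.
rewrite /slope ler_pdivrMl ?subr_gt0// mulrCA ler_pdivlMl ?subr_gt0//.
lra.
Qed.

Let slope_le2 (x y z : R) : x < y -> y < z -> slope y z <= slope x y.
Proof.
move=> xy yz; have xz := lt_trans xy yz; have H := three xy yz.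
rewrite /slope ler_pdivrMl ?subr_gt0// mulrCA ler_pdivlMl ?subr_gt0//.
lra.
Qed.

Let dq (x h : R) := h^-1 * (r (x + h) - r x).

Let dqE (x h : R) : dq x h = slope x (x + h).
Proof. by rewrite /slope addrAC subrr add0r. Qed.

Let dq_noninc (x : R) : {in `]0, +oo[ &, nonincreasing_fun (dq x)}.
Proof.
move=> h k; rewrite !in_itv/= !andbT => h0 k0.
rewrite le_eqVlt => /predU1P[->//|hk].
by rewrite !dqE slope_le1// ?ltrDl// ltrD2l.
Qed.

Let dq_ub (x y h : R) : y < x -> 0 < h -> dq x h <= slope y x.
Proof. by move=> yx h0; rewrite dqE slope_le2// ltrDl. Qed.

Let dq_has_ub (x : R) : has_ubound (dq x @` `]0, +oo[).
Proof.
exists (slope (x - 1) x) => _ [h + <-]; rewrite /= in_itv/= andbT => h0.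
by apply: dq_ub => //; rewrite ltrBlDr ltrDl.
Qed.

Let rderivE (x : R) : rderiv r x = sup (dq x @` `]0, +oo[).
Proof.
rewrite /rderiv; apply: cvg_lim => //.
exact: (@nonincreasing_at_right_cvgr _ (dq x) 0 (BInfty R false)).
Qed.

Let slope_le_rderiv (x y : R) : x < y -> slope x y <= rderiv r x.
Proof.
move=> xy; rewrite rderivE; apply: ub_le_sup => //.
exists (y - x); first by rewrite /= in_itv/= andbT subr_gt0.
by rewrite dqE addrC subrK.
Qed.

Let rderiv_le_slope (x y : R) : y < x -> rderiv r x <= slope y x.
Proof.
move=> yx; rewrite rderivE; apply: ge_sup.
  by exists (dq x 1), 1 => //=; rewrite in_itv/= ltr01.
by move=> _ [h + <-]; rewrite /= in_itv/= andbT => h0; exact: dq_ub.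
Qed.

Let rderiv_noninc (x y : R) : x <= y -> rderiv r y <= rderiv r x.
Proof.
rewrite le_eqVlt => /predU1P[->//|xy].
by rewrite (le_trans (rderiv_le_slope xy))// slope_le_rderiv.
Qed.

Lemma cvg_rderiv (x : R) :
  (fun h : R => h^-1 * (r (x + h) - r x)) @ 0^'+ --> rderiv r x.
Proof.
rewrite rderivE.
exact: (@nonincreasing_at_right_cvgr _ (dq x) 0 (BInfty R false)).
Qed.

Lemma is_cumulative_rderiv : is_cumulative (fun t => - rderiv r t).
Proof.
split=> [x y xy|x]; first by rewrite lerN2 rderiv_noninc.
apply: cvgN; apply/cvgrPdist_le => e e0.
set D := rderiv r x.
have [z xz Dz] : exists2 z, x < z & D - e < slope x z.
  have : D - e < sup (dq x @` `]0, +oo[) by rewrite -rderivE ltrBlDr ltrDl.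
  move=> /sup_gt[|_ [h + <-] H].
    by exists (dq x 1), 1 => //=; rewrite in_itv/= ltr01.
  rewrite /= in_itv/= andbT => h0.
  by exists (x + h); [rewrite ltrDl|rewrite -dqE].
pose g y := (z - y)^-1 * (r z - r x - D * (y - x)).
have gx : g y @[y --> x] --> slope x z.
  have -> : slope x z = g x by rewrite /g subrr mulr0 subr0.
  apply: (@cvgM R R (nbhs x)).
    apply: (@cvgV R R (nbhs x)); first by rewrite subr_eq0 gt_eqF.
    by apply: cvgB; [exact: cvg_cst|exact: cvg_id].
  apply: cvgB; first exact: cvg_cst.
  apply: cvgM; first exact: cvg_cst.
  by apply: cvgB; [exact: cvg_id|exact: cvg_cst].
have gx' : g y @[y --> x^'+] --> slope x z by apply: cvg_at_right_filter.
have Hg : \forall y \near x^'+, D - e < g y.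
  by apply: (cvgr_gt _ gx').
near=> y.
have xy : x < y by near: y; exact: nbhs_right_gt.
have yz : y < z by near: y; exact: nbhs_right_lt.
have gy : g y <= slope y z.
  rewrite /g /slope ler_pM2l ?invr_gt0 ?subr_gt0//.
  have := slope_le_rderiv xy; rewrite /slope ler_pdivrMl ?subr_gt0// -/D.
  lra.
have Dgy : D - e < g y by near: y.
have Dy := slope_le_rderiv yz.
rewrite ger0_norm ?subr_ge0 ?rderiv_noninc ?ltW//.
lra.
Unshelve. all: by end_near. Qed.

End rderiv_concave.

(* Main.v *)
Require Import Defs.
From HB Require Import structures.
From mathcomp Require Import all_boot all_order all_algebra.
From mathcomp Require Import ring lra.
From mathcomp Require Import all_classical all_reals all_analysis.
From mathcomp Require Import measurable_realfun.

Set Implicit Arguments.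
Unset Strict Implicit.
Unset Printing Implicit Defensive.

Import Order.TTheory GRing.Theory Num.Theory.
Import numFieldNormedType.Exports.

Local Open Scope classical_set_scope.
Local Open Scope ring_scope.

(** Why there is at most one solution.

    Fix a path X t = W t - 4 t^3 and, for a solution r, put G_R = H_R - Y_R on
    the right half-line and G_L = H_L - Y_L on the left one.  Formally
    G'' = r - X', the function G is nonpositive, and condition 3 says that G
    vanishes almost everywhere for the measure dr' (the curvature of r).

    Energy.  Let r1 and r2 be solutions, D = r1 - r2 and V = G_1 - G_2 on each
    side of 0.  The path cancels, so V is twice differentiable on each side with
    V'' = D; moreover D 0 = 0, and condition 1 makes V continuous at 0.  For a
    nonnegative cutoff eta supported in [-T, T], integrating by parts twice
    against the curvature measures gives
      int (eta V)'' D = int eta V dD' = - int eta G_1 dr2' - int eta G_2 dr1'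
    because G_1 and G_2 are null for their own curvature, and the right-hand
    side is nonpositive since G_i <= 0 and dr_i' <= 0 ([curvature_by_parts],
    [curvature_cross_ge0], [variational]).  The derivative V' may jump at 0,
    but only through terms that carry D 0 or derivatives of eta at 0, and eta is
    chosen flat there.  Since V'' = D, the integrand (eta V)'' V'' equals, up to
    an exact derivative, eta D^2 + 2 eta'' V D - eta'''' V^2 / 2, which is at
    least eta D^2 / 2 minus a multiple of V^2 / T^4 when everything is scaled
    to height 1 ([cutoff_pointwise], [energy]).  Hence
      int_{|t| <= T/2} D^2 <= C sup_{|t| <= T} V^2 / T^3,
    and D = 0 follows as soon as G t ^ 2 = o(|t|^3) for every solution.

    Growth of G.  An interval where G < 0 carries no curvature, so r is affine
    there, while the drift contributes a quartic.  On a gap [a, b] between two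
    zeros of G the function and its derivative vanish at both ends, which forces
      G t = (t - a)^2 (b - t)^2 + O(E (b - a)),
    E being the oscillation of W over the gap.  As G <= 0 at the midpoint, the
    quartic cannot exceed the noise: (b - a)^3 = O(E) and |G| = O(E (b - a))
    ([gap_estimate]).  If W grows at most linearly then E = O(t), gaps have
    length O(t^(1/3)) and G = O(t^(4/3)), which is o(t^(3/2))
    ([half_line_growth]).  The same quartic excludes an unbounded gap.

    Probability.  Only the continuity and the linear growth of the path of W are
    used.  Linear growth holds almost surely by chaining along the grids of mesh
    2^m / 16^k of [0, 2^m]: the Gaussian tail makes the probabilities that an
    increment of the grid exceeds 2^m / 2^k summable, so Borel-Cantelli applies
    ([normal_prob_tail], [chaining], [ae_no_big_jump]).  The exceptional set
    depends on the path only, so it serves all pairs r1, r2 at once. *)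

(** * Calculus of one real variable *)

Section calculus.
Context {R : realType}.
Implicit Types (f g : R -> R) (a b t : R).
Notation mu := (@lebesgue_measure R).

Lemma is_derive_continuous f t d : is_derive t 1 f d -> {for t, continuous f}.
Proof. by move=> h; exact/differentiable_continuous/derivable1_diffP. Qed.

Lemma derives_continuous f (f' : R -> R) :
  (forall t, is_derive t 1 f (f' t)) -> continuous f.
Proof. by move=> h t; exact: is_derive_continuous (h t). Qed.

Lemma derive_ge0_le f (f' : R -> R) a b : a <= b -> continuous f ->
  (forall t, a < t < b -> is_derive t 1 f (f' t) /\ 0 <= f' t) -> f a <= f b.
Proof.
rewrite le_eqVlt => /predU1P[->//|ab] cf h.
have hd t : t \in `]a, b[ -> is_derive t 1 f (f' t) by rewrite in_itv/= => /h[].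
have [c cab e] := MVT ab hd (continuous_subspaceT cf).
move: cab; rewrite in_itv/= => /h[_ c0].
by rewrite -subr_ge0 e mulr_ge0// subr_ge0 ltW.
Qed.

Lemma derive_eq0_eq f a b : a <= b -> continuous f ->
  (forall t, a < t < b -> is_derive t 1 f 0) -> f b = f a.
Proof.
rewrite le_eqVlt => /predU1P[->//|ab] cf h.
have hd t : t \in `]a, b[ -> is_derive t 1 f (cst 0 t) by rewrite in_itv/= => /h.
have [c _ e] := MVT ab hd (continuous_subspaceT cf).
by apply/eqP; rewrite -subr_eq0 e mul0r.
Qed.

Lemma derive_bounded_lip f (f' : R -> R) a b M : a <= b -> continuous f ->
  (forall t, a < t < b -> is_derive t 1 f (f' t)) ->
  (forall t, a < t < b -> `|f' t| <= M) -> `|f b - f a| <= M * (b - a).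
Proof.
rewrite le_eqVlt => /predU1P[->|ab] cf h hM.
  by rewrite !subrr normr0 mulr0.
have hd t : t \in `]a, b[ -> is_derive t 1 f (f' t) by rewrite in_itv/= => /h.
have [c cab e] := MVT ab hd (continuous_subspaceT cf).
move: cab; rewrite in_itv/= => /hM c0.
by rewrite e normrM [X in _ * X]ger0_norm ?subr_ge0 ?(ltW ab)// ler_wpM2r// subr_ge0 ltW.
Qed.

Lemma continuous_bounded f a b : continuous f ->
  exists M : R, forall t, a <= t <= b -> `|f t| <= M.
Proof.
move=> cf; have [ab|ba] := leP a b; last first.
  by exists 0 => t /andP[h1 h2]; have := lt_le_trans ba (le_trans h1 h2); rewrite ltxx.
have [|c _ h] := @EVT_max R (fun t => `|f t|) a b ab.
  by apply: continuous_subspaceT => t; apply: cvg_norm; exact: cf.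
by exists `|f c| => t tab; apply: h; rewrite in_itv.
Qed.

Lemma continuous_integrable f a b : continuous f ->
  mu.-integrable `[a, b] (EFin \o f).
Proof.
move=> cf; apply: continuous_compact_integrable; first exact: segment_compact.
exact: continuous_subspaceT.
Qed.

(** A base point [m] to the left of both limits turns the oriented integral into
    a difference, which covers the two orientations at once. *)
Lemma oint_sub f m a b : continuous f -> m <= a -> m <= b ->
  oint a b f = \int[mu]_(x in `[m, b]) f x - \int[mu]_(x in `[m, a]) f x.
Proof.
move=> cf.
have key u v : m <= u -> u <= v ->
  \int[mu]_(x in `[u, v]) f x =
  \int[mu]_(x in `[m, v]) f x - \int[mu]_(x in `[m, u]) f x.
  move=> mu_ uv; rewrite Rintegral_itvB//; last exact: continuous_integrable.
  rewrite Rintegral_itv_obnd_cbnd//.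
  apply: integrableS (continuous_integrable u v cf) => //.
  exact: subset_itv_oc_cc.
move=> ma mb; rewrite /oint; case: leP => ab; first exact: key.
by rewrite (key _ _ mb (ltW ab)) opprB.
Qed.

Lemma oint_refl f a : oint a a f = 0.
Proof. by rewrite /oint lexx set_itv1 Rintegral_set1. Qed.

Let base_derive f m t : continuous f -> m < t ->
  is_derive t 1 (fun s => \int[mu]_(x in `[m, s]) f x) (f t).
Proof.
move=> cf mt.
have [h1 h2] := @continuous_FTC1_closed R f m t (t + 1) (ltac:(by rewrite ltrDl))
  (continuous_integrable m (t + 1) cf) mt (cf t).
by apply: DeriveDef; [exact: h1|rewrite -derive1E h2].
Qed.

Lemma oint_is_derive_r f a t : continuous f ->
  is_derive t 1 (fun s => oint a s f) (f t).
Proof.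
move=> cf; pose m := Num.min a t - 1.
have ma : m <= a by rewrite lerBlDr ge_min lerDl ler01.
have mt : m < t by rewrite ltrBlDr gt_min ltrDl ltr01 orbT.
pose k : R := \int[mu]_(x in `[m, a]) f x.
apply: (@near_eq_is_derive _ _ _ (fun s => \int[mu]_(x in `[m, s]) f x - k)).
- near=> s; rewrite (@oint_sub _ m)//.
  by apply: ltW; near: s; exact: lt_nbhsr.
- apply: is_derive_eq; first apply: is_deriveB; first exact: base_derive.
  by rewrite subr0.
Unshelve. all: by end_near. Qed.

Lemma oint_is_derive_l f b t : continuous f ->
  is_derive t 1 (fun s => oint s b f) (- f t).
Proof.
move=> cf; pose m := Num.min b t - 1.
have ma : m <= b by rewrite lerBlDr ge_min lerDl ler01.
have mt : m < t by rewrite ltrBlDr gt_min ltrDl ltr01 orbT.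
pose k : R := \int[mu]_(x in `[m, b]) f x.
apply: (@near_eq_is_derive _ _ _ (fun s => k - \int[mu]_(x in `[m, s]) f x)).
- near=> s; rewrite (@oint_sub _ m)//.
  by apply: ltW; near: s; exact: lt_nbhsr.
- apply: is_derive_eq; first apply: is_deriveB; first exact: base_derive.
  by rewrite sub0r.
Unshelve. all: by end_near. Qed.

End calculus.

(** * Concave functions and their curvature measure *)

Section subdivision.
Context {R : realType}.

(** The increments of [F] are bounded by products of two small increments, so
    over [n] equal pieces they add up to O(1/n).  In the integration by parts
    below all error terms are of the form mesh times (mesh + increment of a
    monotone function). *)
Lemma increment_bound_const (F m : R -> R) (a b K : R) : a <= b ->
  (forall x y, a <= x -> x <= y -> y <= b ->
    `|F y - F x| <= K * ((y - x) * (m y - m x))) ->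
  F b = F a.
Proof.
move=> ab H; apply/eqP; rewrite -subr_eq0 -normr_eq0; apply/eqP.
have N n : `|F b - F a| <= K * ((b - a) * (m b - m a)) / n.+1%:R.
  pose h := (b - a) / n.+1%:R.
  have n0 : (0 : R) < n.+1%:R by rewrite ltr0n.
  have h0 : 0 <= h by rewrite divr_ge0// ?subr_ge0// ltW.
  have hn : a + n.+1%:R * h = b by rewrite /h mulrCA divff ?gt_eqF// mulr1 addrC subrK.
  have step k : (k <= n.+1)%N ->
      `|F (a + k%:R * h) - F a| <= K * (h * (m (a + k%:R * h) - m a)).
    elim: k => [|k IH] kn; first by rewrite mul0r addr0 !subrr normr0 !mulr0.
    have := IH (ltnW kn).
    have e : a + k.+1%:R * h = a + k%:R * h + h.
      by rewrite -natr1 mulrDl mul1r addrA.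
    have kh : 0 <= k%:R * h by rewrite mulr_ge0.
    have := H (a + k%:R * h) (a + k.+1%:R * h).
    rewrite lerDl => /(_ kh); rewrite e lerDl => /(_ h0).
    have -> : a + k%:R * h + h <= b.
      by rewrite -e -hn lerD2l ler_wpM2r// ler_nat.
    move=> /(_ isT); rewrite [X in X * (_ - _)]addrAC subrr add0r => h1 h2.
    rewrite -[X in `|X|](subrKA (F (a + k%:R * h))) addrC.
    apply: le_trans (ler_normD _ _) _; move: (lerD h2 h1).
    rewrite (addrC (F _)) -/(_ - _) => /le_trans; apply.
    rewrite -mulrDr -mulrDr; lra.
  have := step _ (leqnn _); rewrite hn => /le_trans; apply.
  by rewrite /h le_eqVlt; apply/orP; left; apply/eqP; ring.
have [//|c0] : `|F b - F a| = 0 \/ 0 < `|F b - F a|.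
  by have := normr_ge0 (F b - F a); rewrite le_eqVlt => /predU1P[<-|]; [left|right].
set c := `|F b - F a| in N c0 *; set D := K * _ in N.
have := archi_boundP (normr_ge0 (D / c)).
set n := Num.bound _ => Hn.
have := N n; rewrite ler_pdivlMr ?ltr0n// leNgt => /negP[].
rewrite -ltr_pdivrMl// mulrC (le_lt_trans (ler_norm _))// (lt_le_trans Hn)//.
by rewrite ler_nat.
Qed.
End subdivision.

Section concave.
Context {R : realType}.
Variable r : R -> R.
Hypothesis rc : econcave (fun t => (r t)%:E).
Local Notation r' := (rderiv r).

Lemma concave_three (x y z : R) : x < y -> y < z ->
  (z - y) * r x + (y - x) * r z <= (z - x) * r y.
Proof.
move=> xy yz; have zx : 0 < z - x by rewrite subr_gt0 (lt_trans xy).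
have nz : z - x != 0 by rewrite gt_eqF.
have p01 : 0 <= (z - y) / (z - x) <= 1.
  rewrite divr_ge0/= ?subr_ge0 ?(ltW yz) ?(ltW (lt_trans xy yz))//.
  by rewrite ler_pdivrMr// mul1r lerD2l lerN2 ltW.
have := rc x z p01; rewrite -!EFinM -EFinD lee_fin.
have -> : 1 - (z - y) / (z - x) = (y - x) / (z - x) by field.
have -> : (z - y) / (z - x) * x + (y - x) / (z - x) * z = y by field.
rewrite -(ler_pM2l zx); congr (_ <= _); field.
by [].
Qed.

Lemma concave_rderiv_le (x y : R) : x < y -> r y - r x <= r' x * (y - x).
Proof.
move=> xy; have yx0 : 0 < y - x by rewrite subr_gt0.
rewrite -ler_pdivrMr//.
apply: (cvgr_to_ge (@cvg_rderiv _ _ rc x)).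
near=> h.
have h0 : 0 < h by near: h; exact: nbhs_right_gt.
have hy : h < y - x by near: h; exact: nbhs_right_lt.
rewrite ler_pdivrMr// -mulrA ler_pdivlMl//.
have := @concave_three x (x + h) y.
rewrite ltrDl h0 -ltrBrDl hy => /(_ isT isT); nra.
Unshelve. all: by end_near. Qed.

Lemma concave_rderiv_ge (x y : R) : x < y -> r' y * (y - x) <= r y - r x.
Proof.
move=> xy; have yx0 : 0 < y - x by rewrite subr_gt0.
rewrite -ler_pdivlMr//.
apply: (cvgr_to_le (@cvg_rderiv _ _ rc y)).
near=> h.
have h0 : 0 < h by near: h; exact: nbhs_right_gt.
rewrite ler_pdivrMl// mulrA ler_pdivlMr//.
have := @concave_three x y (y + h).
rewrite ltrDl h0 xy => /(_ isT isT); nra.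
Unshelve. all: by end_near. Qed.

Lemma rderiv_nonincreasing (x y : R) : x <= y -> r' y <= r' x.
Proof. by move=> xy; have [/(_ _ _ xy)] := is_cumulative_rderiv rc; rewrite lerN2. Qed.

Lemma rderiv_bounded (a b : R) : exists2 L, 0 <= L &
  forall x, a <= x -> x <= b -> `|r' x| <= L.
Proof.
exists (`|r' a| + `|r' b|) => [|x ax xb]; first by rewrite addr_ge0.
have := rderiv_nonincreasing ax; have := rderiv_nonincreasing xb => h1 h2.
by rewrite ler_norml; have := ler_norm (r' a); have := ler_norm (- r' b);
  have := normr_ge0 (r' a); have := normr_ge0 (r' b); rewrite normrN; lra.
Qed.

Lemma concave_lip (a b L x y : R) :
  (forall z, a <= z -> z <= b -> `|r' z| <= L) ->
  a <= x -> x <= y -> y <= b -> `|r y - r x| <= L * (y - x).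
Proof.
move=> HL ax + yb; rewrite le_eqVlt => /predU1P[->|xy].
  by rewrite !subrr normr0 mulr0.
have := HL x ax (ltW (lt_le_trans xy yb)); have := HL y (ltW (le_lt_trans ax xy)) yb.
rewrite !ler_norml => /andP[h1 h2] /andP[h3 h4].
by have := concave_rderiv_le xy; have := concave_rderiv_ge xy; nra.
Qed.

Lemma concave_continuous : continuous r.
Proof.
move=> x; have [L L0 HL] := rderiv_bounded (x - 1) (x + 1).
apply/cvgrPdist_lt => e e0.
have L1 : 0 < L + 1 by rewrite ltr_wpDl.
near=> y.
have xy1 : `|x - y| < 1 by near: y; exact: cvgr_dist_lt.
have xye : `|x - y| < e / (L + 1).
  by near: y; apply: cvgr_dist_lt => //; rewrite divr_gt0.
have := xye; rewrite ltr_pdivlMr// => lte.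
apply: le_lt_trans lte.
move: xy1; rewrite ltr_norml => /andP[h1 h2].
apply: (@le_trans _ _ (L * `|x - y|)); last first.
  by rewrite mulrDr mulr1 mulrC lerDl.
have [le_xy|lt_yx] := leP x y.
  rewrite distrC (distrC x) [X in _ * X]ger0_norm ?subr_ge0//.
  by apply: concave_lip HL _ _ _; lra.
rewrite [X in _ * X]ger0_norm ?subr_ge0 ?(ltW lt_yx)//.
by apply: concave_lip HL _ _ _; lra.
Unshelve. all: by end_near. Qed.

(** The nonnegative measure -dr'. *)
Definition curvature := stieltjes (fun t => - r' t).

Lemma curvature_itv (a b : R) : a <= b ->
  curvature `]a, b]%classic = (r' a - r' b)%:E.
Proof.
by move=> ab; rewrite stieltjes_itv// ?opprK ?(addrC (- _))//; exact: is_cumulative_rderiv.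
Qed.

Lemma curvature_integrable (f : R -> R) (a b : R) : continuous f ->
  curvature.-integrable `]a, b] (EFin \o f).
Proof.
move=> cf; have [ab|ba] := leP a b; last first.
  by rewrite set_itv_ge ?bnd_simp -?leNgt ?(ltW ba)//; exact: integrable_set0.
have [M HM] := continuous_bounded a b cf.
apply: measurable_bounded_integrable => //.
- by rewrite curvature_itv// ltry.
- by apply: measurable_funTS; exact: continuous_measurable_fun.
- exists M; split; first by rewrite num_real.
  move=> K MK t /=; rewrite in_itv/= => /andP[at_ tb].
  by rewrite (le_trans (HM t _) (ltW MK))// (ltW at_) tb.
Qed.

Lemma curvature_Rintegral_near (f : R -> R) (x y c e : R) : continuous f -> x <= y ->
  (forall t, x <= t -> t <= y -> `|f t - c| <= e) ->
  `|\int[curvature]_(t in `]x, y]) f t - c * (r' x - r' y)| <= e * (r' x - r' y).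
Proof.
move=> cf xy H.
have I0 := curvature_integrable x y cf.
have Ic k : curvature.-integrable `]x, y] (EFin \o cst k).
  by apply: curvature_integrable => ?; exact: cvg_cst.
have Ec k : \int[curvature]_(t in `]x, y]) k = k * (r' x - r' y).
  by rewrite Rintegral_cst// curvature_itv.
rewrite ler_norml; apply/andP; split;
  [rewrite lerBrDl -mulNr -mulrDl -Ec|rewrite lerBlDl -mulrDl -Ec];
  (apply: le_Rintegral; [by []|first [exact: I0|exact: Ic]|first [exact: I0|exact: Ic]|]) => t;
  rewrite /= in_itv/= => /andP[/ltW h1 h2];
  have := H t h1 h2; rewrite ler_norml; lra.
Qed.

Lemma curvature_Rintegral_split (f : R -> R) (a x y : R) : continuous f ->
  a <= x -> x <= y ->
  \int[curvature]_(t in `]a, y]) f t =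
  \int[curvature]_(t in `]a, x]) f t + \int[curvature]_(t in `]x, y]) f t.
Proof.
move=> cf ax xy.
rewrite (@itv_bndbnd_setU _ _ _ (BRight x)) ?bnd_simp//.
rewrite Rintegral_setU//.
- by rewrite -itv_bndbnd_setU ?bnd_simp//; exact: curvature_integrable.
- apply/disj_setPS => t [] /=; rewrite !in_itv/= => /andP[_ tx] /andP[xt _].
  by have := le_lt_trans tx xt; rewrite ltxx.
Qed.

(** Two integrations by parts at once.  With [J] a primitive-like expression for
    the part carried by [r], the combination [F] of both sides has increments
    bounded by the mesh times the increment of [t - r' t]: on a short interval
    [`]x, y]] the first-order parts of the curvature integral, of [f * r'] and of
    [J] cancel, and what remains is quadratic in the mesh or a product of the
    mesh with the curvature of the interval. *)
Lemma curvature_by_parts (f f1 f2 : R -> R) (a b : R) : a <= b ->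
  (forall t : R, is_derive t 1 f (f1 t)) -> (forall t : R, is_derive t 1 f1 (f2 t)) ->
  continuous f2 ->
  \int[curvature]_(t in `]a, b]) f t =
  (f a * r' a - f b * r' b) - (f1 a * r a - f1 b * r b)
  - oint a b (fun t => f2 t * r t).
Proof.
move=> ab df df1 cf2.
have cf := derives_continuous df; have cf1 := derives_continuous df1.
have cr := concave_continuous.
have cfr : continuous (fun t => f2 t * r t) by move=> t; apply: cvgM; [exact: cf2|exact: cr].
pose J t := f1 t * r t - oint a t (fun t => f2 t * r t).
pose F t := \int[curvature]_(t in `]a, t]) f t + f t * r' t - J t.
have [M1 HM1] := continuous_bounded a b cf1.
have [M2 HM2] := continuous_bounded a b cf2.
have [L L0 HL] := rderiv_bounded a b.
have M10 : 0 <= M1 by apply: le_trans (HM1 a _); rewrite ?lexx ?ab.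
have M20 : 0 <= M2 by apply: le_trans (HM2 a _); rewrite ?lexx ?ab.
suff : F b = F a.
  by rewrite /F /J oint_refl set_itvoc0 Rintegral_set0; lra.
apply: (@increment_bound_const _ F (fun t => t - r' t) _ _ (M1 *+ 2 + L * M2 *+ 2)) => // x y ax xy yb.
have xb := le_trans xy yb; have ay := le_trans ax xy.
set h := y - x; have h0 : 0 <= h by rewrite subr_ge0.
set w := r' x - r' y; have w0 : 0 <= w by rewrite subr_ge0 rderiv_nonincreasing.
(* E1-E4 are the first-order expansions over [`]x, y]] of the curvature integral,
   of the Lebesgue integral, of r and of f. *)
have E1 : `|\int[curvature]_(t in `]x, y]) f t - f y * w| <= M1 * h * w.
  apply: curvature_Rintegral_near => // t xt ty.
  rewrite distrC; apply: le_trans (_ : M1 * (y - t) <= _); last by rewrite ler_wpM2l// lerD2l lerN2.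
  apply: derive_bounded_lip (fun t _ => df t) _ => // u /andP[tu uy].
  by apply: HM1; apply/andP; split; lra.
have E2 : `|oint a y (fun t => f2 t * r t) - oint a x (fun t => f2 t * r t)
    - r x * (f1 y - f1 x)| <= M2 * (L * h) * h.
  pose th t := oint a t (fun t => f2 t * r t) - r x * f1 t.
  have dth (t : R) : is_derive t 1 th (f2 t * (r t - r x)).
    have h1 := oint_is_derive_r a t cfr; rewrite /th.
    by apply: is_derive_eq; rewrite /GRing.scale/=; ring.
  have -> : oint a y (fun t => f2 t * r t) - oint a x (fun t => f2 t * r t)
    - r x * (f1 y - f1 x) = th y - th x by rewrite /th; ring.
  apply: derive_bounded_lip (fun t _ => dth t) _ => //; first exact: derives_continuous dth.
  move=> u /andP[xu uy]; rewrite normrM ler_pM ?HM2//; first by apply/andP; split; lra.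
  apply: le_trans (concave_lip HL ax (ltW xu) _) _; first by lra.
  by rewrite ler_wpM2l// lerD2r ltW.
have E3 : `|r y - r x - r' x * h| <= h * w.
  have := xy; rewrite le_eqVlt => /predU1P[e|xy'].
    by rewrite /h e !subrr mulr0 subr0 normr0 mul0r.
  rewrite ler_norml /w /h.
  by have := concave_rderiv_le xy'; have := concave_rderiv_ge xy'; lra.
have E4 : `|f1 y * h - (f y - f x)| <= M2 * h * h.
  pose th t := f1 y * t - f t.
  have dth (t : R) : is_derive t 1 th (f1 y - f1 t).
    have h1 := df t; rewrite /th.
    by apply: is_derive_eq; rewrite /GRing.scale/=; ring.
  have -> : f1 y * h - (f y - f x) = th y - th x by rewrite /th /h; ring.
  apply: derive_bounded_lip (fun t _ => dth t) _ => //; first exact: derives_continuous dth.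
  move=> u /andP[xu uy]; apply: (@le_trans _ _ (M2 * (y - u))).
    apply: derive_bounded_lip (fun t _ => df1 t) _ => //; first exact: ltW.
    by move=> v /andP[uv vy]; apply: HM2; apply/andP; split; lra.
  by rewrite ler_wpM2l// lerD2l lerN2 ltW.
have := HM1 y; rewrite ay yb => /(_ isT) B1; have B2 := HL x ax xb.
set A := _ - _ in E1; set B := _ - _ in E2; set C := _ - _ in E3; set D := _ - _ in E4.
have -> : F y - F x = A - (f1 y * C + r' x * D - B).
  rewrite /F /J (curvature_Rintegral_split cf ax xy) /A /B /C /D /w /h; ring.
apply: le_trans (ler_normB _ _) _.
have T1 : `|f1 y * C + r' x * D - B| <= M1 * (h * w) + L * (M2 * h * h) + M2 * (L * h) * h.
  apply: le_trans (ler_normB _ _) _; apply: lerD => //.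
  by apply: le_trans (ler_normD _ _) _; rewrite !normrM; apply: lerD; apply: ler_pM.
apply: le_trans (lerD E1 T1) _.
have -> : y - r' y - (x - r' x) = h + w by rewrite /h /w; ring.
rewrite -subr_ge0.
have -> : (M1 *+ 2 + L * M2 *+ 2) * (h * (h + w)) - (M1 * h * w +
   (M1 * (h * w) + L * (M2 * h * h) + M2 * (L * h) * h)) =
   2 * (M1 * (h * h)) + 2 * (L * M2 * (h * w)) by ring.
by rewrite addr_ge0// !mulr_ge0.
Qed.

End concave.

Section complementarity.
Context {R : realType}.
Variable r : R -> R.
Hypothesis rc : econcave (fun t => (r t)%:E).
Local Notation r' := (rderiv r).
Variables (A : set R) (G : R -> R).
Hypothesis mA : measurable A.
Hypothesis cG : continuous G.
Hypothesis G_le0 : forall t, A t -> G t <= 0.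
Hypothesis intG : integral_dderiv r A G = 0%E.

(** A nonpositive function with integral zero is null almost everywhere. *)
Lemma curvature_ae0 : ae_eq (curvature r) A (EFin \o G) (cst 0%E).
Proof.
apply/(ae_eq_integral_abs (curvature r) mA).
  apply/measurable_EFinP; apply: measurable_funTS.
  exact: continuous_measurable_fun.
move: intG; rewrite /integral_dderiv -/(curvature r) => /eqP; rewrite oppe_eq0 => /eqP.
have -> : (\int[curvature r]_(t in A) (G t)%:E =
    \int[curvature r]_(t in A) - `|(EFin \o G) t|)%E.
  apply: eq_integral => t /[1!inE] At /=.
  by rewrite ler0_norm ?opprK// G_le0.
rewrite integral_ge0N//= => /eqP; rewrite oppe_eq0 => /eqP; exact.
Qed.

Lemma curvature_Rintegral_eq0 (f : R -> R) (a b : R) : continuous f ->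
  `]a, b] `<=` A -> \int[curvature r]_(t in `]a, b]) (f t * G t) = 0.
Proof.
move=> cf abA; rewrite /Rintegral (@ae_eq_integral _ _ _ (curvature r) _ (cst 0%E))//.
- by rewrite integral0.
- apply/measurable_EFinP; apply: measurable_funTS.
  apply: continuous_measurable_fun => t.
  by apply: cvgM; [exact: cf|exact: cG].
- apply: filterS curvature_ae0 => t h /abA /h /=.
  by move=> [->]; rewrite mulr0.
Qed.

(** Where [G < 0] the curvature measure has no mass, so [r] bends nowhere. *)
Lemma rderiv_const_lt0 (x y : R) : x <= y -> `]x, y] `<=` A ->
  (forall t, x < t -> t <= y -> G t < 0) -> r' y = r' x.
Proof.
move=> xy xyA Gneg.
have : curvature r `]x, y]%classic = 0%E.
  apply: measure_negligible => //.
  apply: negligibleS curvature_ae0 => t /= xty h.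
  have := h (xyA _ xty) => -[Gt0].
  by move: xty; rewrite in_itv/= => /andP[xt ty]; have := Gneg t xt ty; rewrite Gt0 ltxx.
by rewrite curvature_itv// => -[]; lra.
Qed.

End complementarity.

Lemma curvature_Rintegral_le0 {R : realType} (r : R -> R) (f : R -> R) (a b : R) :
  econcave (fun t => (r t)%:E) -> (forall t, a < t -> t <= b -> f t <= 0) ->
  \int[curvature r]_(t in `]a, b]) f t <= 0.
Proof.
move=> rc f0.
have -> : \int[curvature r]_(t in `]a, b]) f t = \int[curvature r]_(t in `]a, b]) - `|f t|.
  apply: eq_Rintegral => t; rewrite inE/= in_itv/= => /andP[a_t tb].
  by rewrite ler0_norm ?opprK// f0.
rewrite /Rintegral; under eq_integral do rewrite EFinN.
rewrite integral_ge0N => [|t _]; last by rewrite lee_fin.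
by rewrite fineN oppr_le0 fine_ge0// integral_ge0// => t _; rewrite lee_fin.
Qed.

(** * Gaps between the zeros of G *)

Section gaps.
Context {R : realType}.

Lemma last_zero (f : R -> R) (u t : R) : continuous f -> u <= t -> f u = 0 -> f t != 0 ->
  exists a, [/\ u <= a, a < t, f a = 0 & forall s : R, a < s -> s <= t -> f s != 0].
Proof.
move=> cf ut fu ft.
pose Z := [set s | u <= s /\ s <= t /\ f s = 0].
have Zu : Z u by [].
have Zub : ubound Z t by move=> s [_ []].
have hZ : has_sup Z by split; [exists u|exists t].
pose a := sup Z.
have ua : u <= a by apply: ub_le_sup => //; exists t.
have at_ : a <= t by apply: ge_sup => //; exists u.
have fa : f a = 0.
  apply/eqP/negPn/negP => fa0.
  have : nbhs a [set s : R | f s != 0] by move: (cf a) fa0; exact: cvgr_neq0.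
  move=> /nbhs_ballP[e/= e0 he].
  have [s [us [st fs]] ase] := sup_adherent e0 hZ.
  have sa : s <= a by apply: ub_le_sup => //; exists t.
  have := he s; rewrite /ball/= ger0_norm ?subr_ge0// fs eqxx => H.
  by suff : false by []; apply: H; move: ase; rewrite -/a; lra.
exists a; split => // [|s as_ st].
  by rewrite lt_neqAle at_ andbT; apply: contra_neq ft => <-.
apply/negP => /eqP fs; suff : s <= a by rewrite leNgt as_.
by apply: ub_le_sup; [exists t|split => //; rewrite (le_trans ua (ltW as_))].
Qed.

Lemma first_zero (f : R -> R) (t u : R) : continuous f -> t <= u -> f u = 0 -> f t != 0 ->
  exists b, [/\ b <= u, t < b, f b = 0 & forall s : R, t <= s -> s < b -> f s != 0].
Proof.
move=> cf tu fu ft.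
have := @last_zero (fun s => f (- s)) (- u) (- t).
rewrite lerN2 !opprK => /(_ _ tu fu ft)[|b [ub bt fb h]].
  move=> s; apply: continuous_comp; [exact: opp_continuous|exact: cf].
exists (- b); split => //; [lra|lra|] => s ts sb.
by rewrite -(opprK s) h//; lra.
Qed.

Variables (W g p : R -> R).
Hypothesis dg : forall t : R, is_derive t 1 g (p t).

(** The shape of the derivative [p] of G on a gap: [al] and [be] come from
    integrating the affine function r, the cubic term from the drift. *)
Definition gap_formula (a b al be : R) := forall t : R, a <= t -> t <= b ->
  p t - p a = al * (t - a) + be * (t - a) ^+ 2 + 4 * (t ^+ 3 - a ^+ 3) - (W t - W a).

(** Integrating the gap formula leaves a quartic with leading coefficient 1; only
    the integral of the noise W - W a separates it from [g]. *)
Lemma gap_quartic (a b al be E : R) : g a = 0 -> p a = 0 -> gap_formula a b al be ->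
  (forall t : R, a <= t -> t <= b -> `|W t - W a| <= E) ->
  forall s : R, 0 <= s -> a + s <= b ->
  `|g (a + s) - (s ^+ 4 + (be / 3 + 4 * a) * s ^+ 3 + (al / 2 + 6 * a ^+ 2) * s ^+ 2)|
    <= E * s.
Proof.
move=> ga pa fo WE s s0 sb.
pose k t := g t - ((t - a) ^+ 4 + (be / 3 + 4 * a) * (t - a) ^+ 3
  + (al / 2 + 6 * a ^+ 2) * (t - a) ^+ 2).
pose k' t := p t - (4 * (t - a) ^+ 3 + (be + 12 * a) * (t - a) ^+ 2
  + (al + 12 * a ^+ 2) * (t - a)).
have dk (t : R) : is_derive t 1 k (k' t).
  have h := dg t; rewrite /k; apply: is_derive_eq; rewrite /GRing.scale/= /k'; by field.
have ka : k a = 0 by rewrite /k ga; ring.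
have -> : g (a + s) - (s ^+ 4 + (be / 3 + 4 * a) * s ^+ 3 + (al / 2 + 6 * a ^+ 2) * s ^+ 2)
  = k (a + s) - k a by rewrite ka /k; ring.
have -> : E * s = E * (a + s - a) by congr (_ * _); ring.
apply: derive_bounded_lip (fun t _ => dk t) _; first by rewrite lerDl.
  exact: derives_continuous dk.
move=> t /andP[at_ ts]; have tb : t <= b by lra.
have := fo t (ltW at_) tb; rewrite pa subr0 /k' => ->.
rewrite -normrN; apply: le_trans (WE t (ltW at_) tb).
by rewrite le_eqVlt; apply/orP; left; apply/eqP; congr `|_|; ring.
Qed.

(** The four conditions g = p = 0 at both ends determine the quartic up to the
    noise: without noise it would be (t - a)^2 (b - t)^2, and the correction
    s^2 (x s + y) is controlled because its value and slope at the right end are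
    of the size of the noise.  Evaluating g <= 0 at the midpoint, where the
    unperturbed quartic equals l^4 / 16, bounds the length of the gap. *)
Lemma gap_estimate (a b al be E : R) : a < b -> g a = 0 -> g b = 0 -> p a = 0 -> p b = 0 ->
  gap_formula a b al be ->
  (forall t : R, a <= t -> t <= b -> `|W t - W a| <= E) ->
  (forall t : R, a <= t -> t <= b -> g t <= 0) ->
  (b - a) ^+ 3 <= 80 * E /\
  forall t : R, a <= t -> t <= b -> `|g t| <= 10 * E * (b - a).
Proof.
move=> ab ga gb pa pb fo WE g0.
set l := b - a; have l0 : 0 < l by rewrite subr_gt0.
have E0 : 0 <= E := le_trans (normr_ge0 _) (WE a (lexx _) (ltW ab)).
have alb : a + l = b by rewrite /l addrC subrK.
pose x := be / 3 + 4 * a + 2 * l; pose y := al / 2 + 6 * a ^+ 2 - l ^+ 2.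
have Q s : 0 <= s -> s <= l ->
    `|g (a + s) - (s ^+ 2 * (l - s) ^+ 2 + s ^+ 2 * (x * s + y))| <= E * s.
  move=> s0 sl.
  have -> : s ^+ 2 * (l - s) ^+ 2 + s ^+ 2 * (x * s + y) =
    s ^+ 4 + (be / 3 + 4 * a) * s ^+ 3 + (al / 2 + 6 * a ^+ 2) * s ^+ 2.
    by rewrite /x /y; ring.
  by apply: (gap_quartic ga pa fo WE s0); rewrite /l in sl; lra.
have H1 : `|x * l + y| <= E / l.
  have := Q l (ltW l0) (lexx _); rewrite alb gb.
  have -> : 0 - (l ^+ 2 * (l - l) ^+ 2 + l ^+ 2 * (x * l + y)) = - (l ^+ 2) * (x * l + y) by ring.
  rewrite normrM normrN (ger0_norm (sqr_ge0 l)) -ler_pdivlMl ?exprn_gt0// => /le_trans; apply.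
  by rewrite le_eqVlt; apply/orP; left; apply/eqP; field; rewrite gt_eqF.
have H2 : `|3 * (x * l) + 2 * y| <= E / l.
  have := fo b (ltW ab) (lexx _); rewrite pa pb -/l => e.
  have {e} e : W b - W a = l * (3 * (x * l) + 2 * y).
    suff -> : W b - W a = al * l + be * l ^+ 2 + 4 * (b ^+ 3 - a ^+ 3) by rewrite /x /y /l; field.
    by lra.
  have := WE b (ltW ab) (lexx _); rewrite e normrM (ger0_norm (ltW l0)).
  by rewrite -ler_pdivlMl// [l^-1 * E]mulrC.
set e := E / l in H1 H2.
have e0 : 0 <= e by rewrite divr_ge0// ltW.
have el : e * l = E by rewrite /e divfK// gt_eqF.
have H3 s : 0 <= s -> s <= l -> `|s ^+ 2 * (x * s + y)| <= 4 * E * l.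
  move=> s0 sl; rewrite normrM (ger0_norm (sqr_ge0 s)).
  have : `|x * s + y| <= 4 * e.
    have yb : `|y| <= 4 * e by move: H1 H2; rewrite !ler_norml; lra.
    have xb : `|x * l + y| <= 4 * e by apply: le_trans H1 _; lra.
    have -> : x * s + y = (1 - s / l) * y + s / l * (x * l + y) by field; rewrite gt_eqF.
    have sl0 : 0 <= s / l by rewrite divr_ge0// ltW.
    have sl1 : s / l <= 1 by rewrite ler_pdivrMr// mul1r.
    apply: le_trans (ler_normD _ _) _.
    rewrite (normrM (1 - s / l)) (normrM (s / l)) (ger0_norm sl0) [X in X * `|y|]ger0_norm ?subr_ge0//.
    nra.
  move=> h; apply: le_trans (_ : l ^+ 2 * (4 * e) <= _).
    by rewrite ler_pM ?sqr_ge0// ler_pXn2r// nnegrE ltW.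
  by rewrite -el; rewrite le_eqVlt; apply/orP; left; apply/eqP; ring.
have H4 s : 0 <= s -> s <= l -> `|g (a + s) - s ^+ 2 * (l - s) ^+ 2| <= 5 * E * l.
  move=> s0 sl; have h1 := Q s s0 sl; have h2 := H3 s s0 sl.
  have h3 : E * s <= E * l by rewrite ler_wpM2l.
  by move: h1 h2; rewrite !ler_norml; lra.
have l4 : l ^+ 4 / 16 <= 5 * E * l.
  have h : l / 2 <= l by lra.
  have h' : 0 <= l / 2 by lra.
  have := H4 _ h' h; have := g0 (a + l / 2); rewrite lerDl h' => /(_ isT).
  have -> : a + l / 2 <= b by rewrite /l; lra.
  move=> /(_ isT) g1; rewrite ler_norml => /andP[+ _].
  have -> : (l / 2) ^+ 2 * (l - l / 2) ^+ 2 = l ^+ 4 / 16 by field.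
  by lra.
split=> [|t at_ tb].
  rewrite -(ler_pM2r l0); have -> : l ^+ 3 * l = l ^+ 4 by rewrite -exprSr.
  by lra.
have := H4 (t - a); rewrite subr_ge0 at_ lerD2r tb => /(_ isT isT).
rewrite (addrC a) subrK; set s := t - a => h.
have : s * (l - s) <= l ^+ 2 / 4 by have := sqr_ge0 (l - 2 * s); lra.
have : 0 <= s * (l - s) by rewrite mulr_ge0 /s /l ?subr_ge0//; lra.
move=> h1 h2; have h3 : (s * (l - s)) ^+ 2 <= (l ^+ 2 / 4) ^+ 2.
  by rewrite ler_pXn2r// nnegrE; lra.
have h4 : 0 <= (s * (l - s)) ^+ 2 by exact: sqr_ge0.
have e1 : (s * (l - s)) ^+ 2 = s ^+ 2 * (l - s) ^+ 2 by rewrite exprMn.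
have e2 : (l ^+ 2 / 4) ^+ 2 = l ^+ 4 / 16 by field.
by move: h; rewrite -e1 !ler_norml; lra.
Qed.

End gaps.

Section half_line.
Context {R : realType}.

(** What both sides of the origin have in common: [g] stands for G_R, or for G_L
    after the reflection t -> -t, [p] for its derivative and [tau] for the
    distance from 0 to the first knot.  The last field says that r is affine as
    long as [g < 0] after [a]. *)
Record half_line_process (W g p : R -> R) (tau C : R) : Prop := HalfLineProcess {
  half_line_base : 0 <= tau ;
  half_line_const : 1 <= C ;
  half_line_noise : forall t : R, 0 <= t -> `|W t| <= C * (1 + t) ;
  half_line_derive : forall t : R, is_derive t 1 g (p t) ;
  half_line_base_zero : g tau = 0 ;
  half_line_base_derive : p tau = 0 ;
  half_line_le0 : forall t : R, 0 <= t -> g t <= 0 ;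
  half_line_gap : forall a : R, 0 <= a -> exists al be, forall t : R, a <= t ->
    (forall s, a < s -> s < t -> g s < 0) -> gap_formula W p a t al be
}.

Lemma half_line_continuous W g p tau C : half_line_process W g p tau C -> continuous g.
Proof. by case=> _ _ _ dg _ _ _ _; exact: derives_continuous dg. Qed.

Lemma half_line_osc (W g p : R -> R) (tau C a b t : R) :
  half_line_process W g p tau C -> 0 <= a -> a <= t -> t <= b -> `|W t - W a| <= 2 * C * (1 + b).
Proof.
move=> HL; have cg := half_line_continuous HL.
have := HL => -[tau0 C1 WC dg gtau ptau g_le0 gapP] a0 at_ tb.
apply: le_trans (ler_normB _ _) _.
have h1 := WC _ (le_trans a0 at_); have h2 := WC _ a0.
have C0 : 0 <= C by exact: le_trans ler01 C1.
have h3 : C * (1 + t) <= C * (1 + b) by rewrite ler_wpM2l// lerD2l.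
have h4 : C * (1 + a) <= C * (1 + b) by rewrite ler_wpM2l// lerD2l (le_trans at_).
lra.
Qed.

(** Away from [tau] a zero of the nonpositive function [g] is an interior
    maximum; at [tau] both values vanish by construction. *)
Lemma half_line_double_zero (W g p : R -> R) (tau C t : R) :
  half_line_process W g p tau C -> tau <= t -> g t = 0 -> p t = 0.
Proof.
move=> HL; have cg := half_line_continuous HL.
have := HL => -[tau0 C1 WC dg gtau ptau g_le0 gapP].
rewrite le_eqVlt => /predU1P[<-//|taut] gt0.
have t0 := le_lt_trans tau0 taut.
have h : is_derive t 1 g 0.
  apply: (@derive1_at_max R g 0 (t + 1)) => [|s _||s].
  - by rewrite addr_ge0// ltW.
  - exact: ex_derive.
  - by rewrite in_itv/= t0 ltrDl ltr01.
  - by rewrite in_itv/= gt0 => /andP[/ltW/g_le0].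
by have [_ <-] := dg t; have [_ <-] := h.
Qed.

(** On an unbounded gap the quartic of the drift would win against an affine r
    and a noise of linear growth, contradicting g <= 0. *)
Lemma half_line_next_zero (W g p : R -> R) (tau C a : R) :
  half_line_process W g p tau C -> tau <= a -> g a = 0 ->
  exists2 b, a < b & ~ (g b < 0).
Proof.
move=> HL; have cg := half_line_continuous HL.
have := HL => -[tau0 C1 WC dg gtau ptau g_le0 gapP] taua ga.
have p_zero := half_line_double_zero HL; have W_osc := half_line_osc HL.
have a0 := le_trans tau0 taua.
apply: contrapT => H.
have neg s : a < s -> g s < 0.
  by move=> as_; apply: contrapT => h; apply: H; exists s.
have [al [be F]] := gapP _ a0.
pose A : R := `|al / 2 + 6 * a ^+ 2|; pose B : R := `|be / 3 + 4 * a|.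
(* Since s >= 1, every lower-order term is at most its coefficient times s^3,
   and s exceeds the sum of these coefficients. *)
pose s := 1 + A + B + 2 * C * (1 + a) + 2 * C.
have A0 : 0 <= A by exact: normr_ge0.
have B0 : 0 <= B by exact: normr_ge0.
have Ca : 0 <= C * a by rewrite mulr_ge0//; lra.
have s1 : 1 <= s by rewrite /s; nra.
have as_ : a < a + s by lra.
have := @gap_quartic R W g p dg a (a + s) al be (2 * C * (1 + (a + s))) ga
  (p_zero _ taua ga).
move=> /(_ (F _ (ltW as_) (fun s h _ => neg s h))).
move=> /(_ (fun t at_ ts => W_osc _ _ _ a0 at_ ts) s).
have s0 : 0 <= s by lra.
move=> /(_ s0 (lexx _)).
set x := be / 3 + 4 * a; set y := al / 2 + 6 * a ^+ 2.
have := neg _ as_; set G := g _ => Gneg.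
rewrite ler_norml => /andP[h _].
have s2 : s <= s ^+ 2 by nra.
have s3 : s ^+ 2 <= s ^+ 3 by rewrite !exprS; nra.
have xs : - (B * s ^+ 3) <= x * s ^+ 3.
  by rewrite -mulNr ler_wpM2r ?exprn_ge0// lerNl /B -normrN ler_norm.
have ys : - (A * s ^+ 3) <= y * s ^+ 2.
  apply: le_trans (_ : - (A * s ^+ 2) <= _); first by rewrite lerN2 ler_wpM2l.
  by rewrite -mulNr ler_wpM2r ?sqr_ge0// lerNl /A -normrN ler_norm.
have e4 : s ^+ 4 = s ^+ 3 + A * s ^+ 3 + B * s ^+ 3 + 2 * C * (1 + a) * s ^+ 3 + 2 * C * s ^+ 3.
  by rewrite exprS {1}/s; ring.
have z1 : 2 * C * (1 + a) * s <= 2 * C * (1 + a) * s ^+ 3.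
  by rewrite ler_wpM2l//; [lra|exact: le_trans s3].
have z2 : 2 * C * s ^+ 2 <= 2 * C * s ^+ 3 by rewrite ler_wpM2l//; lra.
have z3 : 2 * C * (1 + (a + s)) * s = 2 * C * (1 + a) * s + 2 * C * s ^+ 2 by ring.
have s30 : 0 < s ^+ 3 by rewrite exprn_gt0//; lra.
lra.
Qed.

Lemma half_line_around (W g p : R -> R) (tau C t : R) :
  half_line_process W g p tau C -> tau <= t -> g t < 0 -> exists a b,
  [/\ a <= t, t <= b, a < b, (b - a) ^+ 3 <= 80 * (2 * C * (1 + b)) &
   `|g t| <= 10 * (2 * C * (1 + b)) * (b - a)].
Proof.
move=> HL; have cg := half_line_continuous HL.
have := HL => -[tau0 C1 WC dg gtau ptau g_le0 gapP] taut gt0.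
have p_zero := half_line_double_zero HL; have W_osc := half_line_osc HL.
have gtn0 : g t != 0 by rewrite lt_eqF.
have [a [taua at_ ga na]] := last_zero cg taut gtau gtn0.
have a0 := le_trans tau0 taua.
have na' s : a < s -> s <= t -> g s < 0.
  by move=> as_ st; rewrite lt_neqAle na//= g_le0//; lra.
have [c tc gc] : exists2 c, t <= c & g c = 0.
  apply: contrapT => H.
  have neg s : a < s -> g s < 0.
    move=> as_; have [st|ts] := leP s t; first exact: na'.
    rewrite lt_neqAle g_le0 ?andbT; last by lra.
    by apply/eqP => gs; apply: H; exists s => //; exact: ltW.
  by have [b ab] := half_line_next_zero HL taua ga; apply; exact: neg.
have [b [bc tb gb nb]] := first_zero cg tc gc gtn0.
have ab := lt_trans at_ tb.
have neg s : a < s -> s < b -> g s < 0.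
  move=> as_ sb; have [st|ts] := leP s t; first exact: na'.
  by rewrite lt_neqAle nb// ?(ltW ts)// g_le0//; lra.
have [al [be F]] := gapP _ a0.
exists a, b; have [|h1 h2] := gap_estimate dg ab ga gb (p_zero _ taua ga)
  (p_zero _ (le_trans taua (ltW ab)) gb) (F b (ltW ab) neg)
  (fun s h1 h2 => W_osc _ _ _ a0 h1 h2).
  by move=> s as_ _; apply: g_le0; exact: le_trans as_.
by split; rewrite ?(ltW at_) ?(ltW tb)//; apply: h2; exact: ltW.
Qed.

(** With noise O(t) the gap around t has length O(t^(1/3)), hence
    |g t| = O(t^(4/3)).  Cube roots are avoided by arguing on l^3 directly. *)
Lemma half_line_growth (W g p : R -> R) (tau C e : R) :
  half_line_process W g p tau C -> 0 < e ->
  exists2 T, 0 < T & forall t, T <= t -> g t ^+ 2 <= e * t ^+ 3.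
Proof.
move=> HL; have cg := half_line_continuous HL.
have := HL => -[tau0 C1 WC dg gtau ptau g_le0 gapP] e0; pose c := 160 * C; pose d := e / c ^+ 4.
have c1 : 160 <= c by rewrite /c; lra.
have d0 : 0 < d by rewrite divr_gt0// exprn_gt0//; lra.
pose T0 := 4 * c ^+ 4 / d ^+ 2 / d.
have c0 : 0 <= c by lra.
have dp : 0 <= d := ltW d0.
have T00 : 0 <= T0.
  rewrite /T0; apply: divr_ge0 => //; apply: divr_ge0; last exact: exprn_ge0.
  by apply: mulr_ge0; [exact: ler0n|exact: exprn_ge0].
exists (1 + tau + T0); first by lra.
move=> t Tt; have t1 : 1 <= t by lra.
have taut : tau <= t by lra.
have := g_le0 _ (le_trans tau0 taut); rewrite le_eqVlt => /predU1P[->|gt0].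
  by rewrite expr0n/= mulr_ge0// ?exprn_ge0//; lra.
have [a [b [at_ tb ab h3 hg]]] := half_line_around HL taut gt0.
set l := b - a in h3 hg; have l0 : 0 < l by rewrite /l subr_gt0.
have bl : b <= t + l by rewrite /l; lra.
have l3 : l ^+ 3 <= c * (2 * t + l).
  apply: le_trans h3 _.
  have -> : 80 * (2 * C * (1 + b)) = c * (1 + b) by rewrite /c; ring.
  by rewrite ler_wpM2l//; lra.
(* A priori bound on the gap, so that its right end is O(t). *)
have lct : l <= c * t.
  rewrite leNgt; apply/negP => lt_l.
  have lc : c <= l by apply: le_trans (ltW lt_l); rewrite ler_peMr//; lra.
  have : l ^+ 3 <= (c + 2) * l by lra.
  rewrite exprSr ler_pM2r// expr2 => h.
  have : c * c <= l * l by rewrite ler_pM//; lra.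
  by nra.
have l3' : l ^+ 3 <= 2 * c ^+ 2 * t.
  apply: le_trans l3 _; rewrite expr2.
  have : c * (2 * t + l) <= c * (2 * t + c * t) by rewrite ler_wpM2l//; lra.
  have : 0 <= c * t * (c - 2) by apply: mulr_ge0; [apply: mulr_ge0|]; lra.
  by lra.
have hgt : `|g t| <= c ^+ 2 * t * l.
  apply: le_trans hg _; rewrite ler_pM2r//.
  have : 1 + b <= (2 + c) * t by lra.
  move=> h; apply: (@le_trans _ _ (20 * C * ((2 + c) * t))).
    have -> : 10 * (2 * C * (1 + b)) = 20 * C * (1 + b) by ring.
    by rewrite ler_wpM2l//; lra.
  have -> : 20 * C * ((2 + c) * t) = (c / 8 * (2 + c)) * t by rewrite /c; field.
  by rewrite ler_wpM2r//; [lra|rewrite expr2; nra].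
have l2 : l ^+ 2 <= d * t.
  rewrite leNgt; apply/negP => dl.
  have h1 : d * t * l < 2 * c ^+ 2 * t.
    by apply: lt_le_trans l3'; rewrite [_ ^+ 3]exprSr ltr_pM2r.
  have h2 : l < 2 * c ^+ 2 / d.
    rewrite ltr_pdivlMr// -(@ltr_pM2r _ t); last by lra.
    by apply: le_lt_trans h1; rewrite le_eqVlt; apply/orP; left; apply/eqP; ring.
  have h4 : l ^+ 2 < (2 * c ^+ 2 / d) ^+ 2 by rewrite ltr_pXn2r// nnegrE ltW// (lt_trans l0).
  have h5 : d * t < 4 * c ^+ 4 / d ^+ 2.
    apply: lt_trans dl _; apply: lt_le_trans h4 _.
    by rewrite le_eqVlt; apply/orP; left; apply/eqP; field; rewrite gt_eqF.
  by move: h5; rewrite mulrC -ltr_pdivlMr// -/T0; lra.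
have -> : g t ^+ 2 = `|g t| ^+ 2 by rewrite real_normK// num_real.
apply: (@le_trans _ _ ((c ^+ 2 * t * l) ^+ 2)).
  by rewrite ler_pXn2r// nnegrE !mulr_ge0 ?exprn_ge0//; lra.
have -> : (c ^+ 2 * t * l) ^+ 2 = c ^+ 4 * t ^+ 2 * l ^+ 2 by ring.
have -> : e * t ^+ 3 = c ^+ 4 * t ^+ 2 * (d * t).
  by rewrite /d; field; rewrite gt_eqF//; lra.
by rewrite ler_wpM2l// mulr_ge0// exprn_ge0//; lra.
Qed.

End half_line.

(** * The cutoff and the energy inequality *)

Section cutoff.
Context {R : realType}.
Implicit Types T t : R.

(** A power of [T^4 - t^4] with two features: its first three derivatives vanish
    at 0, where V' may jump, and its zeros at T and -T have order 4, so that
    [cutoff2 ^+ 2 / cutoff] is bounded by a multiple of T^12. *)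
Definition cutoff T t : R := (T ^+ 4 - t ^+ 4) ^+ 4.
Definition cutoff1 T t : R := - 16 * t ^+ 3 * (T ^+ 4 - t ^+ 4) ^+ 3.
Definition cutoff2 T t : R :=
  48 * t ^+ 2 * (T ^+ 4 - t ^+ 4) ^+ 2 * (5 * t ^+ 4 - T ^+ 4).
Definition cutoff3 T t : R :=
  96 * t * (T ^+ 4 - t ^+ 4) * (- 35 * t ^+ 8 + 20 * T ^+ 4 * t ^+ 4 - T ^+ 8).
Definition cutoff4 T t : R :=
  96 * (455 * t ^+ 12 - 495 * T ^+ 4 * t ^+ 8 + 105 * T ^+ 8 * t ^+ 4 - T ^+ 12).

Lemma is_derive_cutoff T t : is_derive t 1 (cutoff T) (cutoff1 T t).
Proof. by rewrite /cutoff; apply: is_derive_eq; rewrite /GRing.scale/= /cutoff1; ring. Qed.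

Lemma is_derive_cutoff1 T t : is_derive t 1 (cutoff1 T) (cutoff2 T t).
Proof. by rewrite /cutoff1; apply: is_derive_eq; rewrite /GRing.scale/= /cutoff2; ring. Qed.

Lemma is_derive_cutoff2 T t : is_derive t 1 (cutoff2 T) (cutoff3 T t).
Proof. by rewrite /cutoff2; apply: is_derive_eq; rewrite /GRing.scale/= /cutoff3; ring. Qed.

Lemma is_derive_cutoff3 T t : is_derive t 1 (cutoff3 T) (cutoff4 T t).
Proof. by rewrite /cutoff3; apply: is_derive_eq; rewrite /GRing.scale/= /cutoff4; ring. Qed.

Lemma cutoff2_continuous T : continuous (cutoff2 T).
Proof. exact: derives_continuous (is_derive_cutoff2 T). Qed.

Lemma cutoff_ge0 T t : 0 <= cutoff T t.
Proof. by rewrite /cutoff exprn_even_ge0. Qed.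

Lemma cutoff_at0 T : [/\ cutoff1 T 0 = 0, cutoff2 T 0 = 0 & cutoff3 T 0 = 0].
Proof. by rewrite /cutoff1 /cutoff2 /cutoff3; split; ring. Qed.

Lemma cutoff_atT T : [/\ cutoff T T = 0, cutoff1 T T = 0, cutoff2 T T = 0 & cutoff3 T T = 0].
Proof. by rewrite /cutoff /cutoff1 /cutoff2 /cutoff3; split; ring. Qed.

Lemma cutoff_atNT T : [/\ cutoff T (- T) = 0, cutoff1 T (- T) = 0,
   cutoff2 T (- T) = 0 & cutoff3 T (- T) = 0].
Proof. by rewrite /cutoff /cutoff1 /cutoff2 /cutoff3; split; ring. Qed.

Lemma pow4_le T t : `|t| <= T -> t ^+ 4 <= T ^+ 4.
Proof.
move=> tT; have -> : t ^+ 4 = `|t| ^+ 4.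
  by rewrite -normrX ger0_norm// exprn_even_ge0.
by rewrite ler_pXn2r// nnegrE// (le_trans _ tT).
Qed.

(** Young's inequality for the cross term: completing the square costs
    2 (cutoff2^2 / cutoff) v^2, and both this and the last term are at most a
    multiple of T^12 v^2.  The total constant is 2 * 2304 * 16 + 48 * 1056, which
    is below 360^2. *)
Lemma cutoff_pointwise T t v w M : `|t| <= T -> v ^+ 2 <= M ->
  cutoff T t * w ^+ 2 / 2 - 360 ^+ 2 * T ^+ 12 * M <=
  cutoff T t * w ^+ 2 + 2 * (cutoff2 T t * v * w) - cutoff4 T t * v ^+ 2 / 2.
Proof.
move=> tT vM; have := pow4_le tT.
rewrite /cutoff /cutoff2 /cutoff4.
have v0 := sqr_ge0 v.
set y := t ^+ 2; set Z := T ^+ 4.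
have -> : t ^+ 4 = y ^+ 2 by rewrite /y; ring.
have -> : t ^+ 8 = (y ^+ 2) ^+ 2 by rewrite /y; ring.
have -> : t ^+ 12 = (y ^+ 2) ^+ 3 by rewrite /y; ring.
have -> : T ^+ 8 = Z ^+ 2 by rewrite /Z; ring.
have -> : T ^+ 12 = Z ^+ 3 by rewrite /Z; ring.
set q := y ^+ 2 => qZ; have q0 : 0 <= q by exact: sqr_ge0.
have Z0 := le_trans q0 qZ.
have b1 : q * (5 * q - Z) ^+ 2 <= 16 * Z ^+ 3.
  have : (5 * q - Z) ^+ 2 <= 16 * Z ^+ 2 by nra.
  move=> h; have -> : 16 * Z ^+ 3 = Z * (16 * Z ^+ 2) by ring.
  by rewrite ler_pM// sqr_ge0.
have qq : q ^+ 2 <= Z ^+ 2 by rewrite ler_pXn2r.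
have qqq : q ^+ 3 <= Z ^+ 3 by rewrite ler_pXn2r.
have q2 : 0 <= q ^+ 2 by exact: sqr_ge0.
have q3 : 0 <= q ^+ 3 by exact: exprn_ge0.
have zq : Z * q ^+ 2 <= Z ^+ 3 by rewrite (exprS Z 2) ler_wpM2l.
have zq0 : 0 <= Z * q ^+ 2 by exact: mulr_ge0.
have zzq : Z ^+ 2 * q <= Z ^+ 3 by rewrite (exprSr Z 2) ler_wpM2l// sqr_ge0.
have zzq0 : 0 <= Z ^+ 2 * q by rewrite mulr_ge0// sqr_ge0.
have b2 : 96 * (455 * q ^+ 3 - 495 * Z * q ^+ 2 + 105 * Z ^+ 2 * q - Z ^+ 3) <=
  96 * 1056 * Z ^+ 3 by lra.
have z3 : 0 <= Z ^+ 3 by exact: exprn_ge0.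
have c1 : q * (5 * q - Z) ^+ 2 * v ^+ 2 <= 16 * Z ^+ 3 * M.
  by rewrite ler_pM// mulr_ge0// sqr_ge0.
have c2 : 96 * (455 * q ^+ 3 - 495 * Z * q ^+ 2 + 105 * Z ^+ 2 * q - Z ^+ 3) * v ^+ 2 <=
    96 * 1056 * Z ^+ 3 * M.
  apply: (@le_trans _ _ (96 * 1056 * Z ^+ 3 * v ^+ 2)); first by rewrite ler_wpM2r.
  by apply: ler_wpM2l vM; apply: mulr_ge0 z3; apply: mulr_ge0; exact: ler0n.
have zM : 0 <= Z ^+ 3 * M by rewrite mulr_ge0// (le_trans v0).
have sq := sqr_ge0 ((Z - q) ^+ 2 * w + 2 * (48 * y * (5 * q - Z) * v)).
have e1 : ((Z - q) ^+ 2 * w + 2 * (48 * y * (5 * q - Z) * v)) ^+ 2 / 2 =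
  (Z - q) ^+ 4 * w ^+ 2 / 2 + 2 * (48 * y * (Z - q) ^+ 2 * (5 * q - Z) * v * w)
  + 4608 * (q * (5 * q - Z) ^+ 2 * v ^+ 2) by rewrite /q; field.
lra.
Qed.

Lemma cutoff_center T t : `|t| <= T / 2 -> T ^+ 16 / 2 <= cutoff T t.
Proof.
move=> tT; have := pow4_le tT; have := pow4_le (_ : `|0| <= T / 2).
rewrite normr0 => /(_ (le_trans (normr_ge0 _) tT)); rewrite expr0n/= => T0 tle.
have e4 : (T / 2) ^+ 4 = T ^+ 4 / 16 by field.
rewrite /cutoff; rewrite e4 in tle T0; set Z := T ^+ 4 in tle T0 *.
have -> : T ^+ 16 = Z ^+ 4 by rewrite /Z; ring.
apply: (@le_trans _ _ ((7 / 8 * Z) ^+ 4)).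
  have -> : (7 / 8 * Z) ^+ 4 = 2401 / 4096 * Z ^+ 4 by field.
  have : 0 <= Z ^+ 4 by rewrite exprn_even_ge0.
  lra.
by rewrite ler_pXn2r// ?nnegrE; lra.
Qed.

Variables (V V1 V2 : R -> R).
Hypothesis dV : forall t : R, is_derive t 1 V (V1 t).
Hypothesis dV1 : forall t : R, is_derive t 1 V1 (V2 t).
Hypothesis cV2 : continuous V2.

Definition cutoffV T t := cutoff T t * V t.
Definition cutoffV1 T t := cutoff1 T t * V t + cutoff T t * V1 t.
Definition cutoffV2 T t := cutoff2 T t * V t + 2 * (cutoff1 T t * V1 t) + cutoff T t * V2 t.

Lemma is_derive_cutoffV T t : is_derive t 1 (cutoffV T) (cutoffV1 T t).
Proof.
rewrite /cutoffV; have h1 := is_derive_cutoff T t; have h2 := dV t.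
by apply: is_derive_eq; rewrite /GRing.scale/= /cutoffV1; ring.
Qed.

Lemma is_derive_cutoffV1 T t : is_derive t 1 (cutoffV1 T) (cutoffV2 T t).
Proof.
rewrite /cutoffV1; have h1 := is_derive_cutoff T t; have h2 := dV t.
have h3 := is_derive_cutoff1 T t; have h4 := dV1 t.
by apply: is_derive_eq; rewrite /GRing.scale/= /cutoffV2; ring.
Qed.

Lemma cutoffV2_continuous T : continuous (cutoffV2 T).
Proof.
have c := derives_continuous (is_derive_cutoff T).
have c1 := derives_continuous (is_derive_cutoff1 T).
have cV := derives_continuous dV; have cV1 := derives_continuous dV1.
move=> t; apply: cvgD; last by apply: cvgM; [exact: c|exact: cV2].
apply: cvgD; first by apply: cvgM; [exact: cutoff2_continuous|exact: cV].
by apply: cvgM; [exact: cvg_cst|apply: cvgM; [exact: c1|exact: cV1]].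
Qed.

(** The exact derivative that separates (eta V)'' V'' from a form without V'. *)
Definition boundary T t :=
  cutoff1 T t * V1 t ^+ 2 - cutoff2 T t * V t * V1 t + cutoff3 T t * V t ^+ 2 / 2.

Lemma is_derive_boundary T t : is_derive t 1 (boundary T)
  (cutoffV2 T t * V2 t - (cutoff T t * V2 t ^+ 2 + 2 * (cutoff2 T t * V t * V2 t) -
    cutoff4 T t * V t ^+ 2 / 2)).
Proof.
rewrite /boundary; have h2 := dV t; have h4 := dV1 t.
have h3 := is_derive_cutoff1 T t; have h5 := is_derive_cutoff2 T t.
have h6 := is_derive_cutoff3 T t.
by apply: is_derive_eq; rewrite /GRing.scale/= /cutoffV2; field.
Qed.

(** Integrating the pointwise bound over [a, b]; [boundary] disappears when the
    endpoints are 0, T or -T.  The factor T^16 is the height of the cutoff. *)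
Lemma energy T M a b x y : 0 <= T -> - T <= a -> a <= x -> x <= y -> y <= b -> b <= T ->
  b - a <= T -> - (T / 2) <= x -> y <= T / 2 ->
  boundary T a = 0 -> boundary T b = 0 ->
  (forall t, a <= t -> t <= b -> V t ^+ 2 <= M) ->
  T ^+ 16 / 4 * oint x y (fun t => V2 t ^+ 2) - 360 ^+ 2 * T ^+ 13 * M <=
  oint a b (fun t => cutoffV2 T t * V2 t).
Proof.
move=> T0 Ta ax xy yb bT baT Tx yT Ba Bb HM.
have M0 : 0 <= M by apply: le_trans (HM a (lexx _) _); [exact: sqr_ge0|lra].
pose k := 360 ^+ 2 * T ^+ 12 * M.
have k0 : 0 <= k by apply: mulr_ge0 M0; apply: mulr_ge0; [exact: sqr_ge0|exact: exprn_ge0].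
have cE : continuous (fun t => cutoffV2 T t * V2 t).
  by move=> t; apply: cvgM; [exact: cutoffV2_continuous|exact: cV2].
have cD : continuous (fun t => V2 t ^+ 2).
  by move=> t; apply: cvgM; exact: cV2.
pose f t := oint a t (fun t => cutoffV2 T t * V2 t) - boundary T t + k * t.
pose f' t := cutoff T t * V2 t ^+ 2 + 2 * (cutoff2 T t * V t * V2 t) - cutoff4 T t * V t ^+ 2 / 2 + k.
have df (t : R) : is_derive t 1 f (f' t).
  rewrite /f; have h1 := oint_is_derive_r a t cE; have h2 := is_derive_boundary T t.
  by apply: is_derive_eq; rewrite /GRing.scale/= /f'; ring.
have cf := derives_continuous df.
have f'_ge t : a <= t -> t <= b -> cutoff T t * V2 t ^+ 2 / 2 <= f' t.
  move=> at_ tb; have := @cutoff_pointwise T t (V t) (V2 t) M.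
  rewrite ler_norml => /(_ _ (HM t at_ tb)); rewrite /f' /k => H.
  suff : - T <= t <= T by move=> /H; lra.
  by apply/andP; split; lra.
have f'0 t : a <= t -> t <= b -> 0 <= f' t.
  move=> at_ tb; apply: le_trans (f'_ge t at_ tb).
  by rewrite divr_ge0// mulr_ge0 ?cutoff_ge0// sqr_ge0.
have fax : f a <= f x.
  by apply: derive_ge0_le ax cf _ => t /andP[h1 h2]; split; [exact: df|apply: f'0; lra].
have fyb : f y <= f b.
  by apply: derive_ge0_le yb cf _ => t /andP[h1 h2]; split; [exact: df|apply: f'0; lra].
pose D := oint x y (fun t => V2 t ^+ 2).
have fxy : T ^+ 16 / 4 * D <= f y - f x.
  pose g t := f t - T ^+ 16 / 4 * oint x t (fun t => V2 t ^+ 2).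
  have dg (t : R) : is_derive t 1 g (f' t - T ^+ 16 / 4 * V2 t ^+ 2).
    rewrite /g; have h1 := oint_is_derive_r x t cD; have h2 := df t.
    by apply: is_derive_eq; rewrite /GRing.scale/=; ring.
  have : g x <= g y.
    apply: derive_ge0_le xy (derives_continuous dg) _ => t /andP[h1 h2].
    split; first exact: dg.
    have h3 : a <= t by lra.
    have h4 : t <= b by lra.
    have h5 : `|t| <= T / 2 by rewrite ler_norml; apply/andP; split; lra.
    have := f'_ge t h3 h4; have := ler_wpM2r (sqr_ge0 (V2 t)) (cutoff_center h5); lra.
  by rewrite /g oint_refl /D; lra.
have : f b - f a = oint a b (fun t => cutoffV2 T t * V2 t) + k * (b - a).
  by rewrite /f Ba Bb oint_refl; ring.
have : k * (b - a) <= k * T by rewrite ler_wpM2l.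
have -> : k * T = 360 ^+ 2 * T ^+ 13 * M by rewrite /k; ring.
rewrite -/D; lra.
Qed.

End cutoff.

(** * The processes attached to a solution *)

Section processes_of_solution.
Context {R : realType}.
Implicit Types (X W r : R -> R).

Definition GR X r t := HR r t - YR X r t.
Definition GL X r t := HL r t - YL X r t.
Definition GR1 X r t := oint (tauR r) t r - XR X r t.
Definition GL1 X r t := XL X r t - oint t (tauL r) r.

Lemma tauR_ge0 r : knots r `&` `[0, +oo[ !=set0 -> 0 <= tauR r.
Proof.
move=> h; apply: lb_le_inf => // x [_]; by rewrite /= in_itv/= andbT.
Qed.

Lemma tauL_le0 r : knots r `&` `]-oo, 0] !=set0 -> tauL r <= 0.
Proof.
by move=> h; apply: ge_sup => // x [_]; rewrite /= in_itv.
Qed.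

Lemma is_derive_GR X r (t : R) : continuous X -> continuous r ->
  is_derive t 1 (GR X r) (GR1 X r t).
Proof.
move=> cX cr.
have cI : continuous (fun u => oint (tauR r) u r).
  by apply: (derives_continuous (f' := r)) => u; exact: oint_is_derive_r.
have cXR : continuous (XR X r).
  by move=> u; apply: cvgB; [exact: cX|exact: cvg_cst].
have h1 := oint_is_derive_r (tauR r) t cI.
have h2 := oint_is_derive_r (tauR r) t cXR.
exact: is_deriveB.
Qed.

Lemma is_derive_GL X r (t : R) : continuous X -> continuous r ->
  is_derive t 1 (GL X r) (GL1 X r t).
Proof.
move=> cX cr.
have cI : continuous (fun u => oint u (tauL r) r).
  by apply: (derives_continuous (f' := fun t => - r t)) => u; exact: oint_is_derive_l.
have cXL : continuous (XL X r).
  by move=> u; apply: cvgB; [exact: cvg_cst|exact: cX].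
have h1 := oint_is_derive_l (tauL r) t cI.
have h2 := oint_is_derive_l (tauL r) t cXL.
by apply: is_derive_eq; rewrite /GL1; ring.
Qed.

Lemma GR_tauR X r : GR X r (tauR r) = 0.
Proof. by rewrite /GR /HR /YR !oint_refl subrr. Qed.
Lemma GL_tauL X r : GL X r (tauL r) = 0.
Proof. by rewrite /GL /HL /YL !oint_refl subrr. Qed.
Lemma GR1_tauR X r : GR1 X r (tauR r) = 0.
Proof. by rewrite /GR1 /XR oint_refl !subrr. Qed.
Lemma GL1_tauL X r : GL1 X r (tauL r) = 0.
Proof. by rewrite /GL1 /XL oint_refl !subrr. Qed.

(** If the derivative [q] of [I] is affine on the run of [neg] that starts at
    [a], then [I] is quadratic there, with coefficients that do not depend on how
    far the run is followed; this uniformity is what excludes unbounded gaps. *)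
Lemma affine_run (q I : R -> R) (neg : R -> Prop) (a : R) : continuous I ->
  (forall t : R, is_derive t 1 I (q t)) ->
  (exists c, forall s s' : R, a < s -> s <= s' -> (forall u, a < u -> u <= s' -> neg u) ->
    q s' - q s = c * (s' - s)) ->
  exists al be, forall t : R, a <= t -> (forall s, a < s -> s < t -> neg s) ->
    I t - I a = al * (t - a) + be * (t - a) ^+ 2.
Proof.
move=> cI dI [c Hc].
have [[s0 as0 run0]|norun] := pselect (exists2 s0 : R, a < s0 & forall u, a < u -> u <= s0 -> neg u);
    last first.
  exists 0, 0 => t; rewrite le_eqVlt => /predU1P[->|at_] run; first by rewrite !subrr; ring.
  exfalso; apply: norun; exists ((a + t) / 2) => [|u au ut]; first by lra.
  by apply: run => //; lra.
(* The value at a of the affine function extrapolated from s0, and half its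
   slope. *)
exists (q s0 + c * (a - s0)), (c / 2) => t at_ run.
pose k u := I u - ((q s0 + c * (a - s0)) * (u - a) + c / 2 * (u - a) ^+ 2).
have dk (u : R) : is_derive u 1 k (q u - (q s0 + c * (u - s0))).
  by rewrite /k; have h := dI u; apply: is_derive_eq; rewrite /GRing.scale/=; field.
have : k t = k a.
  apply: (derive_eq0_eq at_ (derives_continuous dk)) => u /andP[au ut].
  have -> : 0 = q u - (q s0 + c * (u - s0)); last exact: dk.
  have [us|su] := leP u s0.
    by have := Hc u s0 au us run0; lra.
  have := Hc s0 u as0 (ltW su); suff run' v : a < v -> v <= u -> neg v by move=> /(_ run'); lra.
  by move=> av vu; apply: run => //; exact: le_lt_trans vu ut.
by rewrite /k subrr mulr0 expr0n/= mulr0 addr0 subr0; lra.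
Qed.

Lemma rderiv_eq_affine r (x y : R) : econcave (fun t => (r t)%:E) -> x <= y ->
  rderiv r y = rderiv r x -> r y - r x = rderiv r x * (y - x).
Proof.
move=> rc + e; rewrite le_eqVlt => /predU1P[->|xy]; first by rewrite !subrr mulr0.
by have := concave_rderiv_le rc xy; have := concave_rderiv_ge rc xy; rewrite e; lra.
Qed.

Lemma char_concave X r : characterization X r -> econcave (fun t => (r t)%:E).
Proof. by case=> -[[]]. Qed.

Lemma char_at0 X r : characterization X r -> r 0 = 0.
Proof. by case=> -[_ []]. Qed.

Section one_solution.
Variables (W r : R -> R).
Hypothesis cW : continuous W.
Let X (t : R) : R := W t - 4 * t ^+ 3.
Hypothesis Hr : characterization X r.

Let cX : continuous X.
Proof.
move=> t; apply: cvgB; first exact: cW.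
by apply: cvgM; [exact: cvg_cst|exact: exprn_continuous].
Qed.

Let rc : econcave (fun t => (r t)%:E) := char_concave Hr.
Let cr : continuous r := concave_continuous rc.

Lemma right_half_line (C : R) : 1 <= C -> (forall t : R, `|W t| <= C * (1 + `|t|)) ->
  half_line_process W (GR X r) (GR1 X r) (tauR r) C.
Proof.
move=> C1 WC; split => //.
- exact: tauR_ge0 (char_tauR Hr).
- by move=> t t0; have := WC t; rewrite (ger0_norm t0).
- by move=> t; exact: is_derive_GR.
- exact: GR_tauR.
- exact: GR1_tauR.
- by move=> t t0; exact: (char_leR Hr t0).
move=> a a0.
have cG : continuous (GR X r).
  by apply: (@derives_continuous _ _ (GR1 X r)) => t; exact: is_derive_GR.
have G_le0 t : `[0, +oo[%classic t -> GR X r t <= 0.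
  by rewrite /= in_itv/= andbT => t0; exact: (char_leR Hr t0).
pose neg t := GR X r t < 0.
have dI (t : R) : is_derive t 1 (fun t => oint (tauR r) t r) (r t).
  exact: oint_is_derive_r.
have [|al [be H]] := @affine_run r _ neg a (derives_continuous dI) dI.
  have const s s' : a < s -> s <= s' -> (forall u, a < u -> u <= s' -> neg u) ->
      rderiv r s' = rderiv r s.
    move=> as_ ss run.
    apply: (@rderiv_const_lt0 _ r rc `[0, +oo[%classic (GR X r)) => //.
    - exact: char_intR Hr.
    - move=> u /=; rewrite !in_itv/= andbT => /andP[su _].
      by rewrite (le_trans a0)// (le_trans (ltW as_))// ltW.
    - by move=> t st ts; apply: run => //; exact: lt_trans st.
  have [[s0 as0 run0]|norun] := pselect (exists2 s0 : R, a < s0 & forall u, a < u -> u <= s0 -> neg u).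
    exists (rderiv r s0) => s s' as_ ss run.
    have e1 := const _ _ as_ ss run.
    rewrite (rderiv_eq_affine rc ss e1); congr (_ * _).
    have [h|h] := leP s s0; first by rewrite (const _ _ as_ h run0).
    rewrite (const s0 s as0 (ltW h))// => u au us; apply: run => //; exact: le_trans us ss.
  exists 0 => s s' as_ ss run; exfalso; apply: norun; exists s' => //.
  exact: lt_le_trans ss.
exists al, be => t at_ run u au ut.
have := H u au (fun s h1 h2 => run s h1 (lt_le_trans h2 ut)).
by rewrite /GR1 /XR /X; lra.
Qed.

(** The reflection t -> -t sends the drift -4 t^3 to itself and W to -W(-t). *)
Lemma left_half_line (C : R) : 1 <= C -> (forall t : R, `|W t| <= C * (1 + `|t|)) ->
  half_line_process (fun t => - W (- t)) (fun t => GL X r (- t)) (fun t => - GL1 X r (- t))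
    (- tauL r) C.
Proof.
move=> C1 WC; split => //.
- by rewrite oppr_ge0; exact: tauL_le0 (char_tauL Hr).
- by move=> t t0; have := WC (- t); rewrite !normrN (ger0_norm t0).
- move=> t; have h1 := is_derive_GL (- t) cX cr.
  have h2 : is_derive t 1 (-%R : R -> R) (-1) by exact: is_deriveNid.
  have := is_derive1_comp h1 h2; rewrite mulrN1; exact.
- by rewrite opprK; exact: GL_tauL.
- by rewrite opprK GL1_tauL oppr0.
- by move=> t t0; apply: (char_leL Hr); rewrite oppr_le0.
move=> a a0.
have cG : continuous (GL X r).
  by apply: (@derives_continuous _ _ (GL1 X r)) => t; exact: is_derive_GL.
have G_le0 t : `]-oo, 0]%classic t -> GL X r t <= 0.
  by rewrite /= in_itv/= => t0; exact: (char_leL Hr t0).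
pose neg t := GL X r (- t) < 0.
have dI (t : R) : is_derive t 1 (fun t => oint (- t) (tauL r) r) (r (- t)).
  have h1 := oint_is_derive_l (tauL r) (- t) cr.
  have h2 : is_derive t 1 (-%R : R -> R) (-1) by exact: is_deriveNid.
  have := is_derive1_comp h1 h2; rewrite mulrN1 opprK; exact.
have [|al [be H]] := @affine_run (fun t => r (- t)) _ neg a (derives_continuous dI) dI.
  have const s s' : a < s -> s <= s' -> (forall u, a < u -> u <= s' -> neg u) ->
      rderiv r (- s) = rderiv r (- s').
    move=> as_ ss run.
    apply: (@rderiv_const_lt0 _ r rc `]-oo, 0]%classic (GL X r)) => //.
    - exact: char_intL Hr.
    - by rewrite lerN2.
    - by move=> u /=; rewrite !in_itv/= => /andP[_ us]; lra.
    - move=> t st ts; have := run (- t); rewrite /neg opprK; apply; lra.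
  have [[s0 as0 run0]|norun] := pselect (exists2 s0 : R, a < s0 & forall u, a < u -> u <= s0 -> neg u).
    exists (- rderiv r (- s0)) => s s' as_ ss run.
    have e1 := const _ _ as_ ss run.
    have ss' : - s' <= - s by rewrite lerN2.
    have := rderiv_eq_affine rc ss' e1.
    have -> : rderiv r (- s') = rderiv r (- s0); last by lra.
    have [h|h] := leP s0 s'; first by rewrite (const s0 s' as0 h run).
    by rewrite (const s' s0 _ (ltW h) run0)//; exact: lt_le_trans ss.
  exists 0 => s s' as_ ss run; exfalso; apply: norun; exists s' => //.
  exact: lt_le_trans ss.
exists al, be => t at_ run u au ut.
have := H u au (fun s h1 h2 => run s h1 (lt_le_trans h2 ut)).
rewrite /GL1 /XL /X.
have -> : (- u) ^+ 3 = - u ^+ 3 by ring.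
have -> : (- a) ^+ 3 = - a ^+ 3 by ring.
by lra.
Qed.

End one_solution.
End processes_of_solution.

(** * Uniqueness for a fixed path *)

Section uniqueness.
Context {R : realType}.

Lemma is_deriveB_cst (f g : R -> R) (t a b k : R) :
  is_derive t 1 f a -> is_derive t 1 g b -> is_derive t 1 (fun u => f u - g u + k) (a - b).
Proof. by move=> hf hg; apply: is_derive_eq; rewrite addr0. Qed.

Lemma half_line_bounded (W g p : R -> R) (tau C e : R) : half_line_process W g p tau C -> 0 < e ->
  exists2 M, 0 <= M & forall T t : R, 0 <= t -> t <= T -> g t ^+ 2 <= M + e * T ^+ 3.
Proof.
move=> HL e0; have [T0 T00 HT] := half_line_growth HL e0.
have [M HM] := continuous_bounded 0 T0 (half_line_continuous HL).
exists (M ^+ 2) => [|T t t0 tT]; first exact: sqr_ge0.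
have T3 : 0 <= e * T ^+ 3 by rewrite mulr_ge0 ?(ltW e0)// exprn_ge0// (le_trans t0).
have [tT0|Tt] := leP t T0.
  have := HM t; rewrite t0 tT0 => /(_ isT) h.
  apply: (@le_trans _ _ (M ^+ 2)); last by rewrite lerDl.
  have -> : g t ^+ 2 = `|g t| ^+ 2 by rewrite real_normK// num_real.
  by rewrite ler_pXn2r// nnegrE (le_trans _ h).
apply: le_trans (HT t (ltW Tt)) _; apply: (@le_trans _ _ (e * T ^+ 3)); last by rewrite lerDr sqr_ge0.
by rewrite ler_wpM2l ?(ltW e0)// ler_pXn2r// nnegrE// (le_trans t0).
Qed.

Lemma oint_mulB (f u v : R -> R) (a b : R) : continuous f -> continuous u -> continuous v ->
  oint a b (fun t => f t * u t) - oint a b (fun t => f t * v t) =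
  oint a b (fun t => f t * (u t - v t)).
Proof.
move=> cf cu cv.
have c1 : continuous (fun t => f t * u t) by move=> t; apply: cvgM; [exact: cf|exact: cu].
have c2 : continuous (fun t => f t * v t) by move=> t; apply: cvgM; [exact: cf|exact: cv].
have c3 : continuous (fun t => f t * (u t - v t)).
  by move=> t; apply: cvgM; [exact: cf|apply: cvgB; [exact: cu|exact: cv]].
pose k t := oint a t (fun t => f t * u t) - oint a t (fun t => f t * v t) -
  oint a t (fun t => f t * (u t - v t)).
have dk (t : R) : is_derive t 1 k 0.
  have h1 := oint_is_derive_r a t c1; have h2 := oint_is_derive_r a t c2.
  have h3 := oint_is_derive_r a t c3.
  by rewrite /k; apply: is_derive_eq; ring.
by have := is_derive_0_is_cst b a dk; rewrite /k !oint_refl; lra.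
Qed.

(** Each [G_i] is null for its own curvature, so only the cross terms survive,
    and they have a sign. *)
Lemma curvature_cross_ge0 (r1 r2 G1 G2 f : R -> R) (A : set R) (a b : R) :
  econcave (fun t => (r1 t)%:E) -> econcave (fun t => (r2 t)%:E) ->
  measurable A -> `]a, b] `<=` A ->
  continuous f -> continuous G1 -> continuous G2 -> (forall t, 0 <= f t) ->
  (forall t, A t -> G1 t <= 0) -> (forall t, A t -> G2 t <= 0) ->
  integral_dderiv r1 A G1 = 0%E -> integral_dderiv r2 A G2 = 0%E ->
  0 <= \int[curvature r1]_(t in `]a, b]) (f t * (G1 t - G2 t)) -
       \int[curvature r2]_(t in `]a, b]) (f t * (G1 t - G2 t)).
Proof.
move=> c1 c2 mA abA cf cG1 cG2 f0 G10 G20 i1 i2.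
have cfG G : continuous G -> continuous (fun t => f t * G t).
  by move=> cG t; apply: cvgM; [exact: cf|exact: cG].
have split_ r : econcave (fun t => (r t)%:E) ->
    \int[curvature r]_(t in `]a, b]) (f t * (G1 t - G2 t)) =
    \int[curvature r]_(t in `]a, b]) (f t * G1 t) - \int[curvature r]_(t in `]a, b]) (f t * G2 t).
  move=> rc; rewrite -RintegralB//; first by apply: eq_Rintegral => t _; rewrite mulrBr.
  - exact: (curvature_integrable rc _ _ (cfG _ cG1)).
  - exact: (curvature_integrable rc _ _ (cfG _ cG2)).
rewrite !split_//.
rewrite (curvature_Rintegral_eq0 mA cG1 G10 i1 cf abA).
rewrite (curvature_Rintegral_eq0 mA cG2 G20 i2 cf abA).
have s1 : \int[curvature r1]_(t in `]a, b]) (f t * G2 t) <= 0.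
  apply: curvature_Rintegral_le0 => // t at_ tb; apply: mulr_ge0_le0 => //.
  by apply: G20; apply: abA; rewrite /= in_itv/= at_.
have s2 : \int[curvature r2]_(t in `]a, b]) (f t * G1 t) <= 0.
  apply: curvature_Rintegral_le0 => // t at_ tb; apply: mulr_ge0_le0 => //.
  by apply: G10; apply: abA; rewrite /= in_itv/= at_.
by rewrite sub0r subr0 -opprD oppr_ge0 -[leRHS]addr0 lerD.
Qed.

Definition subcubic (X r : R -> R) := forall e : R, 0 < e -> exists2 M, 0 <= M &
  forall T t : R, 0 <= t -> t <= T ->
    GR X r t ^+ 2 <= M + e * T ^+ 3 /\ GL X r (- t) ^+ 2 <= M + e * T ^+ 3.

Lemma solution_subcubic (W r : R -> R) (C : R) : continuous W ->
  characterization (fun t => W t - 4 * t ^+ 3) r ->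
  1 <= C -> (forall t : R, `|W t| <= C * (1 + `|t|)) ->
  subcubic (fun t => W t - 4 * t ^+ 3) r.
Proof.
move=> cW Hr C1 WC e e0.
have [M1 M10 HM1] := half_line_bounded (right_half_line cW Hr C1 WC) e0.
have [M2 M20 HM2] := half_line_bounded (left_half_line cW Hr C1 WC) e0.
exists (M1 + M2) => [|T t t0 tT]; first exact: addr_ge0.
split.
- by apply: le_trans (HM1 T t t0 tT) _; rewrite lerD2r lerDl.
- by apply: le_trans (HM2 T t t0 tT) _; rewrite lerD2r lerDr.
Qed.

Section two_solutions.
Variables (X r1 r2 : R -> R).
Hypothesis cX : continuous X.
Hypothesis H1 : characterization X r1.
Hypothesis H2 : characterization X r2.

Let c1 := char_concave H1.
Let c2 := char_concave H2.
Let cr1 : continuous r1 := concave_continuous c1.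
Let cr2 : continuous r2 := concave_continuous c2.

Let D t := r1 t - r2 t.
Let VR t := GR X r1 t - GR X r2 t.
Let VL t := GL X r1 t - GL X r2 t.
Let VR1 t := GR1 X r1 t - GR1 X r2 t.
Let VL1 t := GL1 X r1 t - GL1 X r2 t.

Let cD : continuous D.
Proof. by move=> t; apply: cvgB; [exact: cr1|exact: cr2]. Qed.

Let dVR (t : R) : is_derive t 1 VR (VR1 t).
Proof.
have h1 := is_derive_GR t cX cr1; have h2 := is_derive_GR t cX cr2.
exact: (@is_deriveB _ _ _ (GR X r1) (GR X r2) t 1 _ _ h1 h2).
Qed.

Let dVL (t : R) : is_derive t 1 VL (VL1 t).
Proof.
have h1 := is_derive_GL t cX cr1; have h2 := is_derive_GL t cX cr2.
exact: (@is_deriveB _ _ _ (GL X r1) (GL X r2) t 1 _ _ h1 h2).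
Qed.

Let dVR1 (t : R) : is_derive t 1 VR1 (D t).
Proof.
have -> : VR1 = fun t => oint (tauR r1) t r1 - oint (tauR r2) t r2 + (X (tauR r1) - X (tauR r2)).
  have alg (a a' x b b' : R) : (a - (x - b)) - (a' - (x - b')) = a - a' + (b - b') by ring.
  by apply/funext => u; exact: alg.
apply: is_deriveB_cst; exact: oint_is_derive_r.
Qed.

Let dVL1 (t : R) : is_derive t 1 VL1 (D t).
Proof.
have -> : VL1 = fun t => oint t (tauL r2) r2 - oint t (tauL r1) r1 + (X (tauL r1) - X (tauL r2)).
  have alg (a a' x b b' : R) : ((b - x) - a) - ((b' - x) - a') = a' - a + (b - b') by ring.
  by apply/funext => u; exact: alg.
have -> : D t = - r2 t - - r1 t by rewrite opprK addrC.
apply: is_deriveB_cst; exact: oint_is_derive_l.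
Qed.

Let V0 : VL 0 = VR 0.
Proof.
by rewrite /VL /VR; congr (_ - _); [exact: esym (char_eq0 H1)|exact: esym (char_eq0 H2)].
Qed.

(** Both sides of 0 are needed: each integration by parts leaves a boundary term
    [cutoff T 0 * V 0 * r' 0], and the two cancel because [VL 0 = VR 0].  The
    terms with [V' 0] vanish since both solutions are 0 at 0. *)
Lemma variational (T : R) : 0 < T ->
  oint 0 T (fun t => cutoffV2 VR VR1 D T t * D t) +
  oint (- T) 0 (fun t => cutoffV2 VL VL1 D T t * D t) <= 0.
Proof.
move=> T0; have [e1 e2 e3] := cutoff_at0 T.
have [t0 t1 _ _] := cutoff_atT T; have [n0 n1 _ _] := cutoff_atNT T.
have cETA : continuous (cutoff T) := derives_continuous (is_derive_cutoff T).
have cE2R : continuous (cutoffV2 VR VR1 D T) := @cutoffV2_continuous _ _ _ _ dVR dVR1 cD T.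
have cE2L : continuous (cutoffV2 VL VL1 D T) := @cutoffV2_continuous _ _ _ _ dVL dVL1 cD T.
have right r : econcave (fun t => (r t)%:E) -> r 0 = 0 ->
    \int[curvature r]_(t in `]0, T]) (cutoff T t * VR t) =
    cutoff T 0 * VR 0 * rderiv r 0 - oint 0 T (fun t => cutoffV2 VR VR1 D T t * r t).
  move=> rc r0.
  rewrite (curvature_by_parts rc (ltW T0) (is_derive_cutoffV dVR T) (is_derive_cutoffV1 dVR dVR1 T) cE2R).
  by rewrite /cutoffV /cutoffV1 t0 t1 r0; ring.
have left r : econcave (fun t => (r t)%:E) -> r 0 = 0 ->
    \int[curvature r]_(t in `](- T), 0]) (cutoff T t * VL t) =
    - (cutoff T 0 * VR 0 * rderiv r 0) - oint (- T) 0 (fun t => cutoffV2 VL VL1 D T t * r t).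
  move=> rc r0; have NT : - T <= 0 by lra.
  rewrite (curvature_by_parts rc NT (is_derive_cutoffV dVL T) (is_derive_cutoffV1 dVL dVL1 T) cE2L).
  by rewrite /cutoffV /cutoffV1 n0 n1 r0 V0; ring.
have cGR r : continuous r -> continuous (GR X r).
  by move=> cr; apply: (@derives_continuous _ _ (GR1 X r)) => t; exact: is_derive_GR.
have cGL r : continuous r -> continuous (GL X r).
  by move=> cr; apply: (@derives_continuous _ _ (GL1 X r)) => t; exact: is_derive_GL.
have SR := @curvature_cross_ge0 r1 r2 (GR X r1) (GR X r2) (cutoff T) `[0, +oo[%classic 0 T c1 c2.
have SL := @curvature_cross_ge0 r1 r2 (GL X r1) (GL X r2) (cutoff T) `]-oo, 0]%classic (- T) 0 c1 c2.
have {}SR : 0 <= \int[curvature r1]_(t in `]0, T]) (cutoff T t * VR t) -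
       \int[curvature r2]_(t in `]0, T]) (cutoff T t * VR t).
  apply: SR => //; [|exact: cGR|exact: cGR|exact: cutoff_ge0| | |exact: char_intR H1|exact: char_intR H2].
  - by move=> t /=; rewrite !in_itv/= andbT => /andP[/ltW].
  - by move=> t; rewrite /= in_itv/= andbT => u0; exact: (char_leR H1 u0).
  - by move=> t; rewrite /= in_itv/= andbT => u0; exact: (char_leR H2 u0).
have {}SL : 0 <= \int[curvature r1]_(t in `](- T), 0]) (cutoff T t * VL t) -
       \int[curvature r2]_(t in `](- T), 0]) (cutoff T t * VL t).
  apply: SL => //; [|exact: cGL|exact: cGL|exact: cutoff_ge0| | |exact: char_intL H1|exact: char_intL H2].
  - by move=> t /=; rewrite !in_itv/= => /andP[].
  - by move=> t; rewrite /= in_itv/= => u0; exact: (char_leL H1 u0).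
  - by move=> t; rewrite /= in_itv/= => u0; exact: (char_leL H2 u0).
have r10 := char_at0 H1; have r20 := char_at0 H2.
rewrite !right// in SR; rewrite !left// in SL.
rewrite -!oint_mulB//; lra.
Qed.


(** T is taken so large that V^2 is at most 5 e T^3 on [-T, T]; the energy
    inequality then has the same power of T on both sides. *)
Lemma energy_vanishes (S e : R) : subcubic X r1 -> subcubic X r2 ->
  0 <= S -> 0 < e ->
  oint 0 S (fun t => D t ^+ 2) + oint (- S) 0 (fun t => D t ^+ 2) <= 40 * (360 ^+ 2 * e).
Proof.
move=> B1 B2 S0 e0.
have [M1 M10 HM1] := B1 e e0; have [M2 M20 HM2] := B2 e e0.
pose m := 2 * (M1 + M2); have m0 : 0 <= m by rewrite /m; lra.
have mm : M1 + M2 <= m / 2 by rewrite /m; lra.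
have me : 0 <= m / e by rewrite divr_ge0// ltW.
pose T := 1 + 2 * S + m / e; have T1 : 1 <= T by rewrite /T; lra.
have T0 : 0 < T by lra.
have T3 : T <= T ^+ 3 by rewrite ler_eXnr.
have meT : m <= e * T ^+ 3.
  apply: (@le_trans _ _ (e * T)); last by rewrite ler_wpM2l// ltW.
  by rewrite mulrC -ler_pdivrMr// /T; lra.
pose M := 5 * e * T ^+ 3.
have sqB (x y k1 k2 : R) : k1 + k2 <= m / 2 -> x ^+ 2 <= k1 + e * T ^+ 3 ->
    y ^+ 2 <= k2 + e * T ^+ 3 -> (x - y) ^+ 2 <= M.
  by move=> h h1 h2; have := sqr_ge0 (x + y); rewrite /M; lra.
have VRM t : 0 <= t -> t <= T -> VR t ^+ 2 <= M.
  move=> t0 tT; have [h1 _] := HM1 T t t0 tT; have [h2 _] := HM2 T t t0 tT.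
  exact: (sqB _ _ M1 M2 mm h1 h2).
have VLM t : - T <= t -> t <= 0 -> VL t ^+ 2 <= M.
  move=> Tt t0; have nt0 : 0 <= - t by lra.
  have ntT : - t <= T by lra.
  have [_] := HM1 T (- t) nt0 ntT; have [_] := HM2 T (- t) nt0 ntT.
  rewrite opprK => h2 h1.
  exact: (sqB _ _ M1 M2 mm h1 h2).
have [a1 a2 a3] := cutoff_at0 T; have [_ b1 b2 b3] := cutoff_atT T.
have [_ n1 n2 n3] := cutoff_atNT T.
have ST : S <= T / 2 by rewrite /T; lra.
have ER : T ^+ 16 / 4 * oint 0 S (fun t => D t ^+ 2) - 360 ^+ 2 * T ^+ 13 * M <=
    oint 0 T (fun t => cutoffV2 VR VR1 D T t * D t).
  apply: (energy dVR dVR1 cD) => //; rewrite ?/boundary; try lra.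
  - by rewrite a1 a2 a3; ring.
  - by rewrite b1 b2 b3; ring.
have EL : T ^+ 16 / 4 * oint (- S) 0 (fun t => D t ^+ 2) - 360 ^+ 2 * T ^+ 13 * M <=
    oint (- T) 0 (fun t => cutoffV2 VL VL1 D T t * D t).
  apply: (energy dVL dVL1 cD) => //; rewrite ?/boundary; try lra.
  - by rewrite n1 n2 n3; ring.
  - by rewrite a1 a2 a3; ring.
move: ER EL (variational T0).
move: (oint 0 T _) (oint (- T) 0 _) (oint 0 S _) (oint (- S) 0 _) => p q u v ER EL pq.
have T16 : 0 < T ^+ 16 by rewrite exprn_gt0.
rewrite -(ler_pM2l T16).
have -> : T ^+ 16 * (40 * (360 ^+ 2 * e)) = 8 * (360 ^+ 2 * T ^+ 13 * M) by rewrite /M; ring.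
move: ER EL; move: (360 ^+ 2 * T ^+ 13 * M) (T ^+ 16) => k Z ER EL.
lra.
Qed.

Lemma solutions_agree : subcubic X r1 -> subcubic X r2 -> r1 = r2.
Proof.
move=> B1 B2.
have cD2 : continuous (fun t => D t ^+ 2) by move=> t; apply: cvgM; exact: cD.
pose f t := oint 0 t (fun t => D t ^+ 2); pose h t := oint t 0 (fun t => D t ^+ 2).
have df (t : R) : is_derive t 1 f (D t ^+ 2) by exact: oint_is_derive_r.
have dh (t : R) : is_derive t 1 h (- (D t ^+ 2)) by exact: oint_is_derive_l.
have f_ge0 t : 0 <= t -> 0 <= f t.
  move=> t0; rewrite -(oint_refl (fun t => D t ^+ 2) 0).
  apply: derive_ge0_le t0 (derives_continuous df) _ => u _.
  by split; [exact: df|exact: sqr_ge0].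
have h_ge0 t : 0 <= t -> 0 <= h (- t).
  move=> t0; rewrite -(oint_refl (fun t => D t ^+ 2) 0) -lerN2 -/(h 0).
  have nt0 : - t <= 0 by lra.
  have dh' (u : R) : is_derive u 1 (fun u => - h u) (D u ^+ 2).
    by have h1 := dh u; apply: is_derive_eq; rewrite opprK.
  apply: derive_ge0_le nt0 (derives_continuous dh') _ => u _.
  by split; [exact: dh'|exact: sqr_ge0].
have zero t : 0 <= t -> f t = 0 /\ h (- t) = 0.
  move=> t0; have ft := f_ge0 t t0; have ht := h_ge0 t t0.
  suff : f t + h (- t) <= 0 by split; lra.
  apply/ler_addgt0Pr => e e0; rewrite add0r.
  have c0 : (0 : R) < 40 * 360 ^+ 2 by rewrite mulr_gt0 ?exprn_gt0 ?ltr0n.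
  have := energy_vanishes B1 B2 t0 (divr_gt0 e0 c0).
  by rewrite mulrA mulrCA divff ?gt_eqF// mulr1.
apply/funext => t; apply/eqP; rewrite -subr_eq0 -/(D t); apply/eqP.
have [t0|t0|->] := ltgtP t 0; last by rewrite /D (char_at0 H1) (char_at0 H2) subrr.
- have : is_derive t 1 h 0.
    apply: (@near_eq_is_derive _ _ _ (cst (0 : R))).
    near=> u; have u0 : u < 0 by near: u; exact: lt_nbhsl.
    by have [_] := zero (- u) (ltac:(by rewrite oppr_ge0 ltW)); rewrite opprK => ->.
  move=> [_ e1]; have [_ e2] := dh t; move: e2; rewrite e1 => /esym/eqP.
  by rewrite oppr_eq0 sqrf_eq0 => /eqP.
- have : is_derive t 1 f 0.
    apply: (@near_eq_is_derive _ _ _ (cst (0 : R))).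
    near=> u; have u0 : 0 < u by near: u; exact: lt_nbhsr.
    by have [->] := zero u (ltW u0).
  move=> [_ e1]; have [_ e2] := df t; move: e2; rewrite e1 => /esym/eqP.
  by rewrite sqrf_eq0 => /eqP.
Unshelve. all: by end_near. Qed.

End two_solutions.

Lemma pathwise_uniqueness (W r1 r2 : R -> R) (C : R) : continuous W ->
  1 <= C -> (forall t : R, `|W t| <= C * (1 + `|t|)) ->
  characterization (fun t => W t - 4 * t ^+ 3) r1 ->
  characterization (fun t => W t - 4 * t ^+ 3) r2 -> r1 = r2.
Proof.
move=> cW C1 WC H1 H2.
apply: (solutions_agree _ H1 H2); last 2 first.
- exact: solution_subcubic cW H1 C1 WC.
- exact: solution_subcubic cW H2 C1 WC.
move=> t; apply: cvgB; first exact: cW.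
by apply: cvgM; [exact: cvg_cst|exact: exprn_continuous].
Qed.

End uniqueness.

(** * Almost sure linear growth of Brownian paths *)

Section gaussian_tail.
Context {R : realType}.

(** Compare the density with that of twice the standard deviation: for |x| > l
    their ratio is at most 2 exp(- 3 l^2 / (8 s^2)), and the wider density
    integrates to at most 1.  The exponential is then traded for a power, which
    is summable enough for the chaining. *)
Lemma normal_prob_tail (s l : R) : 0 < s -> 0 < l ->
  (normal_prob 0 s [set x : R | l < `|x|]%R <= (228 * s ^+ 6 / l ^+ 6)%R%:E)%E.
Proof.
move=> s0 l0; have sn : s != 0 by rewrite gt_eqF.
have s2n : 2 * s != 0 by rewrite mulf_neq0.
pose y := 3 / 8 * l ^+ 2 / s ^+ 2.
have y0 : 0 < y by rewrite !(divr_gt0, mulr_gt0, exprn_gt0).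
have Ky : 2 * expR (- y) <= 228 * s ^+ 6 / l ^+ 6.
  rewrite expRN; have := expR_ge1Dxn 2 (ltW y0) => h.
  have h' : y ^+ 3 / 6 <= expR y.
    by apply: le_trans h; rewrite (_ : 3`!%:R = 6 :> R)// lerDr.
  have y3 : 0 < y ^+ 3 / 6 by rewrite divr_gt0// exprn_gt0.
  apply: (@le_trans _ _ (2 * (y ^+ 3 / 6)^-1)).
    by rewrite ler_pM2l// lef_pV2// posrE ?expR_gt0.
  have -> : 2 * (y ^+ 3 / 6)^-1 = 2048 / 9 * (s ^+ 6 / l ^+ 6).
    by rewrite /y; field; rewrite sn gt_eqF.
  by rewrite -[leRHS]mulrA ler_wpM2r ?divr_ge0 ?exprn_ge0 ?ltW//; lra.
pose B := [set x : R | l < `|x|].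
have mB : measurable B.
  rewrite [B](_ : _ = (fun x : R => `|x|) @^-1` `]l, +oo[%classic); last first.
    by apply/seteqP; split => x /=; rewrite in_itv/= andbT.
  by rewrite -[X in measurable X]setTI; exact: normr_measurable.
have mpdf (u : R) (A : set R) : measurable_fun A (EFin \o normal_pdf 0 u).
  by apply/measurable_EFinP; apply: measurable_funTS; exact: measurable_normal_pdf.
have pdf_le x : B x -> normal_pdf 0 s x <= 2 * expR (- y) * normal_pdf 0 (2 * s) x.
  rewrite /B/= => lx; rewrite !normal_pdfE// /normal_fun !subr0.
  have -> : normal_peak s = 2 * normal_peak (2 * s) :> R.
    rewrite /normal_peak.
    have -> : (2 * s) ^+ 2 * pi *+ 2 = 2 ^+ 2 * (s ^+ 2 * pi *+ 2) :> R by ring.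
    rewrite sqrtrM ?sqr_ge0// sqrtr_sqr ger0_norm// invfM mulrA divff// mul1r//.
  rewrite -!mulrA ler_pM2l// [leRHS]mulrCA ler_wpM2l ?normal_peak_ge0// -expRD ler_expR.
  have x2 : l ^+ 2 <= x ^+ 2.
    rewrite -[x ^+ 2]real_normK ?num_real// ler_pXn2r// ?nnegrE ?(ltW l0)//.
    exact: ltW.
  have -> : - x ^+ 2 / (s ^+ 2 *+ 2) = - (x ^+ 2 / (2 * s ^+ 2)) by field.
  have -> : - x ^+ 2 / ((2 * s) ^+ 2 *+ 2) = - (x ^+ 2 / (8 * s ^+ 2)) by field.
  rewrite -opprD lerN2.
  have -> : x ^+ 2 / (2 * s ^+ 2) = 3 / 8 * x ^+ 2 / s ^+ 2 + x ^+ 2 / (8 * s ^+ 2) by field.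
  by rewrite lerD2r ler_pM2r ?invr_gt0 ?exprn_gt0// ler_pM2l.
rewrite /normal_prob; apply: le_trans (_ : _ <= (2 * expR (- y))%:E)%E _; last by rewrite lee_fin.
apply: (@le_trans _ _ (\int[lebesgue_measure]_(x in B)
   ((2 * expR (- y))%:E * (normal_pdf 0 (2 * s) x)%:E))%E).
  apply: ge0_le_integral => //.
  - by move=> x _; rewrite lee_fin normal_pdf_ge0.
  - exact: mpdf.
  - by apply: emeasurable_funM => //; exact: mpdf.
have k0 : 0 <= 2 * expR (- y) by rewrite mulr_ge0// expR_ge0.
have -> : (\int[lebesgue_measure]_(x in B)
   ((2 * expR (- y))%:E * (normal_pdf 0 (2 * s) x)%:E) =
   (2 * expR (- y))%:E * \int[lebesgue_measure]_(x in B) (normal_pdf 0 (2 * s) x)%:E)%E.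
  apply: ge0_integralZl => //; first exact: mpdf.
  by move=> x _; rewrite lee_fin normal_pdf_ge0.
rewrite -[leRHS]mule1; apply: lee_wpmul2l; first by rewrite lee_fin.
rewrite -(@integral_normal_pdf R 0 (2 * s)).
apply: ge0_subset_integral => //; first exact: mpdf.
by move=> x _; rewrite lee_fin normal_pdf_ge0.
Qed.

End gaussian_tail.

Section chaining.
Context {R : realType}.

Lemma natr_pow16 k : (16 ^ k)%:R = 16 ^+ k :> R.
Proof. by rewrite natrX. Qed.

(** A point of the grid of level k+1 is at most 15 steps of that level away from
    a point of level k, so the bounds 15 L / 2^k add up geometrically. *)
Lemma chaining_grid (f : R -> R) (L : R) : 0 <= L ->
  (forall k j, (j < 16 ^ k)%N ->
    `|f (j.+1%:R * (L / 16 ^+ k)) - f (j%:R * (L / 16 ^+ k))| <= L / 2 ^+ k) ->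
  forall k j, (j <= 16 ^ k)%N ->
    `|f (j%:R * (L / 16 ^+ k)) - f 0| <= L * (16 - 15 / 2 ^+ k).
Proof.
move=> L0 H; elim=> [|k IH] j.
  rewrite expn0 !expr0 divr1; case: j => [|[|//]] _.
    by rewrite mul0r subrr normr0; lra.
  have := H 0%N 0%N isT; rewrite !expr0 mul0r divr1 mul1r => /le_trans; apply.
  by lra.
move=> jk; pose q := (j %/ 16)%N; pose i := (j %% 16)%N.
have ji : j = (q * 16 + i)%N by exact: divn_eq.
have i16 : (i <= 15)%N by rewrite -ltnS ltn_mod.
have qk : (q <= 16 ^ k)%N.
  by rewrite -(@leq_pmul2r 16)// -expnSr (leq_trans _ jk)// leq_divM.
have walk m : (q * 16 + m <= 16 ^ k.+1)%N ->
    `|f ((q * 16 + m)%:R * (L / 16 ^+ k.+1)) - f ((q * 16)%:R * (L / 16 ^+ k.+1))| <=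
      m%:R * (L / 2 ^+ k.+1).
  elim: m => [|m IHm] hm; first by rewrite addn0 subrr normr0 mul0r.
  rewrite addnS in hm *; have := H k.+1 _ hm; have := IHm (ltnW hm) => h1 h2.
  rewrite -(subrKA (f ((q * 16 + m)%:R * (L / 16 ^+ k.+1)))).
  apply: le_trans (ler_normD _ _) _; apply: le_trans (lerD h2 h1) _.
  by rewrite -[m.+1%:R]natr1 mulrDl mul1r addrC.
have := IH q qk; have := walk i; rewrite -ji => /(_ jk).
have -> : (q * 16)%:R * (L / 16 ^+ k.+1) = q%:R * (L / 16 ^+ k) :> R.
  by rewrite natrM exprSr; field; rewrite expf_neq0.
move=> h1 h2.
rewrite -(subrKA (f (q%:R * (L / 16 ^+ k)))).
apply: le_trans (ler_normD _ _) _; apply: le_trans (lerD h1 h2) _.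
have p0 : (0 : R) < 2 ^+ k.+1 by rewrite exprn_gt0.
have h3 : i%:R * (L / 2 ^+ k.+1) <= 15 * (L / 2 ^+ k.+1).
  by rewrite ler_wpM2r ?divr_ge0 ?(ltW p0)// ler_nat.
apply: le_trans (lerD h3 (lexx _)) _.
rewrite le_eqVlt; apply/orP; left; apply/eqP.
by rewrite exprS; field; rewrite expf_neq0.
Qed.

Lemma chaining (f : R -> R) (L : R) : 0 < L -> continuous f ->
  (forall k j, (j < 16 ^ k)%N ->
    `|f (j.+1%:R * (L / 16 ^+ k)) - f (j%:R * (L / 16 ^+ k))| <= L / 2 ^+ k) ->
  forall t : R, 0 <= t -> t <= L -> `|f t - f 0| <= 16 * L.
Proof.
move=> L0 cf H t t0 tL; apply/ler_addgt0Pr => e e0.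
have : nbhs t [set s : R | `|f t - f s| < e] by move: (cf t) => /cvgr_dist_lt; apply.
move=> /nbhs_ballP[d/= d0 hd].
pose k := Num.bound (L / d).
have p0 : (0 : R) < 16 ^+ k by rewrite exprn_gt0.
have Lk : L / 16 ^+ k < d.
  rewrite ltr_pdivrMr// mulrC -ltr_pdivrMr//.
  have Ld : 0 <= L / d by rewrite divr_ge0 ?ltW.
  apply: lt_le_trans (archi_boundP Ld) _; rewrite -/k -natr_pow16 ler_nat.
  by apply: ltnW; apply: ltn_expl.
pose x := t / (L / 16 ^+ k); pose j := Num.truncn x.
have w0 : 0 < L / 16 ^+ k by rewrite divr_gt0.
have x0 : 0 <= x by rewrite divr_ge0// ltW.
have /andP[j1 j2] := truncn_itv x0.
have xL : x <= (16 ^ k)%:R.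
  by rewrite natr_pow16 /x ler_pdivrMr// mulrC divfK// gt_eqF.
have jk : (j <= 16 ^ k)%N by rewrite -(ler_nat R) (le_trans j1).
have tx : t = x * (L / 16 ^+ k) by rewrite /x divfK// gt_eqF.
have cl : `|t - j%:R * (L / 16 ^+ k)| < d.
  rewrite {1}tx -mulrBl normrM (gtr0_norm w0) ger0_norm ?subr_ge0//.
  apply: le_lt_trans Lk; rewrite ler_piMl ?(ltW w0)//.
  by move: j2; rewrite -natr1 -/j; lra.
have h1 := hd _ cl; have h2 := chaining_grid (ltW L0) H jk.
rewrite -(subrKA (f (j%:R * (L / 16 ^+ k)))).
apply: le_trans (ler_normD _ _) _; rewrite addrC; apply: lerD (ltW h1).
apply: le_trans h2 _; rewrite mulrC ler_pM2r// lerBlDr lerDl divr_ge0// exprn_ge0//.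
Qed.

(** Apply the chaining on [0, 2^m] for a power 2^m >= t that is at most a
    constant times 1 + t. *)
Lemma linear_growth (f : R -> R) (N : nat) : continuous f ->
  (forall m k j, (N <= m)%N -> (j < 16 ^ k)%N ->
    `|f (j.+1%:R * (2 ^+ m / 16 ^+ k)) - f (j%:R * (2 ^+ m / 16 ^+ k))| <= 2 ^+ m / 2 ^+ k) ->
  forall t : R, 0 <= t -> `|f t - f 0| <= 32 * 2 ^+ N * (1 + t).
Proof.
move=> cf H t t0.
have /andP[n1 n2] := truncn_itv t0; set n := Num.truncn t in n1 n2.
have /andP[p1 p2] := @trunc_log_bounds 2 n.+1 isT isT.
set p := trunc_log 2 n.+1 in p1 p2.
have tp : t <= 2 ^+ (N + p.+1).
  apply: le_trans (ltW n2) _; rewrite -natrX ler_nat.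
  by apply: leq_trans (ltnW p2) _; rewrite leq_exp2l// leq_addl.
have L0 : (0 : R) < 2 ^+ (N + p.+1) by rewrite exprn_gt0.
have := @chaining f (2 ^+ (N + p.+1)) L0 cf _ t t0 tp.
move=> /(_ (fun k j => H (N + p.+1)%N k j (leq_addr _ _))) /le_trans; apply.
rewrite exprD exprS; have -> : 16 * (2 ^+ N * (2 * 2 ^+ p)) = 32 * 2 ^+ N * 2 ^+ p :> R by ring.
rewrite ler_wpM2l ?mulr_ge0 ?exprn_ge0// -natrX.
apply: (@le_trans _ _ n.+1%:R); first by rewrite ler_nat.
by rewrite -natr1 addrC lerD2l.
Qed.

End chaining.

Section brownian_growth.
Context (R : realType) (d : measure_display) (T : measurableType d) (P : probability T R).

Lemma increment_tail (W : R -> {RV P >-> R}) (s t l : R) :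
  two_sided_brownian_motion W -> s != t -> 0 < l ->
  (P [set w | l < `|W t w - W s w|]%R <= (228 * `|t - s| ^+ 3 / l ^+ 6)%R%:E)%E.
Proof.
move=> hW; wlog st : s t / s < t.
  move=> H; rewrite neq_lt => /orP[st|ts] l0; first by apply: H => //; rewrite lt_eqF.
  rewrite distrC; under eq_set do rewrite distrC.
  by apply: H => //; rewrite lt_eqF.
move=> _ l0; pose B := [set x : R | l < `|x|].
have mB : measurable B.
  rewrite [B](_ : _ = (fun x : R => `|x|) @^-1` `]l, +oo[%classic); last first.
    by apply/seteqP; split => x /=; rewrite in_itv/= andbT.
  by rewrite -[X in measurable X]setTI; exact: normr_measurable.
have ts0 : 0 < t - s by rewrite subr_gt0.
have q0 : 0 < Num.sqrt (t - s) by rewrite sqrtr_gt0.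
have := normal_prob_tail q0 l0.
rewrite -(bm_gaussian_increments hW st mB) => /le_trans; apply.
rewrite lee_fin (gtr0_norm ts0).
have -> : Num.sqrt (t - s) ^+ 6 = (Num.sqrt (t - s) ^+ 2) ^+ 3 by rewrite -exprM.
by rewrite sqr_sqrtr// ltW.
Qed.

Variable Z : R -> {RV P >-> R}.
Hypothesis Z_tail : forall s t l : R, s != t -> 0 < l ->
  (P [set w | l < `|Z t w - Z s w|]%R <= (228 * `|t - s| ^+ 3 / l ^+ 6)%R%:E)%E.

Definition big_jump (m k j : nat) : set T :=
  [set w | 2 ^+ m / 2 ^+ k <
    `|Z (j.+1%:R * (2 ^+ m / 16 ^+ k)) w - Z (j%:R * (2 ^+ m / 16 ^+ k)) w|].

Lemma measurable_big_jump m k j : measurable (big_jump m k j).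
Proof.
pose a : R := 2 ^+ m / 2 ^+ k; pose u : R := j.+1%:R * (2 ^+ m / 16 ^+ k).
pose v : R := j%:R * (2 ^+ m / 16 ^+ k).
rewrite (_ : big_jump _ _ _ = (fun w => `|Z u w - Z v w|) @^-1` `]a, +oo[%classic); last first.
  by apply/seteqP; split => w /=; rewrite in_itv/= andbT.
rewrite -[X in measurable X]setTI.
have : measurable_fun [set: T] (fun w => `|Z u w - Z v w|).
  by apply: measurableT_comp => //; apply: measurable_funB.
exact.
Qed.

Lemma big_jump_prob m k j : (P (big_jump m k j) <= (228 / (8 ^+ m * 64 ^+ k))%R%:E)%E.
Proof.
have w0 : (0 : R) < 2 ^+ m / 16 ^+ k by rewrite divr_gt0 ?exprn_gt0.
have l0 : (0 : R) < 2 ^+ m / 2 ^+ k by rewrite divr_gt0 ?exprn_gt0.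
have h : j%:R * (2 ^+ m / 16 ^+ k) != j.+1%:R * (2 ^+ m / 16 ^+ k) :> R.
  by rewrite -[j.+1%:R]natr1 mulrDl mul1r lt_eqF// ltrDl.
apply: le_trans (Z_tail h l0) _; rewrite lee_fin -mulrBl.
rewrite -[j.+1%:R]natr1 [_ + 1 - _]addrAC subrr add0r mul1r (gtr0_norm w0).
have e8 : 8 ^+ m = (2 ^+ m) ^+ 3 :> R by rewrite -exprM mulnC exprM; congr (_ ^+ _); ring.
have e64 : 64 ^+ k = (2 ^+ k) ^+ 6 :> R by rewrite -exprM mulnC exprM; congr (_ ^+ _); ring.
have e16 : 16 ^+ k = (2 ^+ k) ^+ 4 :> R by rewrite -exprM mulnC exprM; congr (_ ^+ _); ring.
rewrite e8 e64 e16 le_eqVlt; apply/orP; left; apply/eqP; field.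
by rewrite !expf_neq0.
Qed.

(** Grouping the levels k on [0, 2^m] by m + k = n leaves one index for
    Borel-Cantelli, and every n involves finitely many increments only. *)
Definition jumps (n : nat) : set T :=
  \big[setU/set0]_(m < n.+1) \big[setU/set0]_(j < 16 ^ (n - m)) big_jump m (n - m) j.

Lemma measurable_jumps n : measurable (jumps n).
Proof.
by apply: bigsetU_measurable => m _; apply: bigsetU_measurable => j _; exact: measurable_big_jump.
Qed.

Lemma jumps_prob n : (P (jumps n) <= (456 / (2 ^ n.+1)%:R)%R%:E)%E.
Proof.
have mJ m : measurable (\big[setU/set0]_(j < 16 ^ (n - m)) big_jump m (n - m) j).
  by apply: bigsetU_measurable => j _; exact: measurable_big_jump.
apply: le_trans (@Boole_inequality _ _ _ P
  (fun m => \big[setU/set0]_(j < 16 ^ (n - m)) big_jump m (n - m) j) n.+1 (fun m _ => mJ m)) _.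
apply: (@le_trans _ _ (\sum_(m < n.+1) (228 / 4 ^+ n)%R%:E)%E).
  apply: lee_sum => -[m mn] _ /=.
  apply: le_trans (@Boole_inequality _ _ _ P (big_jump m (n - m)) _
    (fun j _ => measurable_big_jump m (n - m) j)) _.
  apply: (@le_trans _ _ (\sum_(j < 16 ^ (n - m)) (228 / (8 ^+ m * 64 ^+ (n - m)))%R%:E)%E).
    by apply: lee_sum => j _; exact: big_jump_prob.
  rewrite sumEFin lee_fin sumr_const card_ord -[leLHS]mulr_natl natr_pow16.
  set k := (n - m)%N.
  have -> : n = (m + k)%N by rewrite /k subnKC.
  have e64 : 64 ^+ k = 16 ^+ k * 4 ^+ k :> R by rewrite -exprMn; congr (_ ^+ _); ring.
  have e8 : 8 ^+ m = 4 ^+ m * 2 ^+ m :> R by rewrite -exprMn; congr (_ ^+ _); ring.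
  rewrite e64 e8 exprD.
  have -> : 16 ^+ k * (228 / (4 ^+ m * 2 ^+ m * (16 ^+ k * 4 ^+ k))) =
    (228 / (4 ^+ m * 4 ^+ k)) / 2 ^+ m :> R by field; rewrite !expf_neq0.
  rewrite ler_pdivrMr ?exprn_gt0//; apply: ler_peMr.
    by apply: divr_ge0; [exact: ler0n|apply: mulr_ge0; exact: exprn_ge0].
  by apply: exprn_ege1; rewrite ler1n.
rewrite sumEFin lee_fin sumr_const card_ord -[leLHS]mulr_natl natrX.
have e4 : 4 ^+ n = 2 ^+ n * 2 ^+ n :> R by rewrite -exprMn; congr (_ ^+ _); ring.
rewrite e4 exprS.
have p0 : (0 : R) < 2 ^+ n by rewrite exprn_gt0.
have -> : 456 / (2 * 2 ^+ n) = 2 ^+ n * (228 / (2 ^+ n * 2 ^+ n)) :> R.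
  by field; rewrite gt_eqF.
rewrite ler_pM2r ?divr_gt0 ?mulr_gt0// -natrX ler_nat.
exact: ltn_expl.
Qed.

Lemma ae_no_big_jump : {ae P, forall w, exists N, forall m k j,
  (N <= m)%N -> (j < 16 ^ k)%N ->
  `|Z (j.+1%:R * (2 ^+ m / 16 ^+ k)) w - Z (j%:R * (2 ^+ m / 16 ^+ k)) w| <= 2 ^+ m / 2 ^+ k}.
Proof.
exists (lim_sup_set jumps); split.
- by apply: bigcap_measurable => // n _; apply: bigcup_measurable => i _; exact: measurable_jumps.
- apply: lim_sup_set_cvg0; first exact: measurable_jumps.
  have := @epsilon_trick R (fun=> 0%E) 456 xpredT (fun=> lexx _) (ler0n _ _).
  rewrite (@eseries0 R (fun=> 0%E) 0 xpredT)// add0r => h.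
  apply: le_lt_trans (ltry 456); apply: le_trans h.
  by apply: lee_nneseries => // n _; rewrite add0r; exact: jumps_prob.
move=> w /= H N _; apply: contrapT => nJ; apply: H; exists N => m k j Nm jk.
rewrite leNgt; apply/negP => big; apply: nJ.
exists (m + k)%N => /=; first exact: leq_trans (leq_addr _ _).
have mk : (m < (m + k).+1)%N by rewrite ltnS leq_addr.
rewrite /jumps (bigD1 (Ordinal mk))//=; left.
by rewrite addKn (bigD1 (Ordinal jk))//=; left; exact: big.
Qed.

Lemma ae_linear_growth : {ae P, forall w, continuous (fun t => Z t w : R) ->
  exists2 C, 0 <= C & forall t : R, 0 <= t -> `|Z t w - Z 0 w| <= C * (1 + t)}.
Proof.
apply: filterS ae_no_big_jump => w [N HN] cZ.
exists (32 * 2 ^+ N); first by rewrite mulr_ge0// exprn_ge0.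
by move=> t t0; apply: (linear_growth cZ) t0.
Qed.

End brownian_growth.

(** Negative times are covered by the process t -> W (- t), whose increments
    have the same tails. *)
Lemma ae_path_growth (R : realType) (d : measure_display) (T : measurableType d)
    (P : probability T R) (W : R -> {RV P >-> R}) :
  two_sided_brownian_motion W ->
  {ae P, forall w, continuous (fun t => W t w : R) ->
    exists2 C, 1 <= C & forall t : R, `|W t w| <= C * (1 + `|t|)}.
Proof.
move=> hW.
have tail' (s t l : R) : s != t -> 0 < l ->
    (P [set w | l < `|W (- t) w - W (- s) w|]%R <= (228 * `|t - s| ^+ 3 / l ^+ 6)%R%:E)%E.
  move=> st l0; have -> : `|t - s| = `|- t - - s| by rewrite -opprD normrN.
  by apply: increment_tail hW _ l0; rewrite eqr_opp.
have h1 := ae_linear_growth (Z := W) (fun s t l st l0 => increment_tail hW st l0).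
have h2 := ae_linear_growth (Z := fun t => W (- t)) tail'.
apply: filterS2 h1 h2 => w g1 g2 cw.
have [C1 C10 H1] := g1 cw.
have [|C2 C20 H2] := g2.
  by move=> t; apply: (@continuous_comp _ _ _ -%R (fun t => W t w)); [exact: opp_continuous|exact: cw].
exists (1 + `|W 0 w| + C1 + C2) => [|t]; first by rewrite -!addrA lerDl !addr_ge0.
have n0 := normr_ge0 t; have w0 := normr_ge0 (W 0 w).
have key : `|W t w - W 0 w| <= (C1 + C2) * (1 + `|t|).
  have [t0|t0] := leP 0 t.
    apply: le_trans (H1 t t0) _; rewrite (ger0_norm t0).
    by rewrite ler_wpM2r ?addr_ge0// lerDl.
  have nt0 : 0 <= - t by lra.
  have := H2 (- t) nt0; rewrite opprK oppr0 => /le_trans; apply.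
  by rewrite (ltr0_norm t0) ler_wpM2r ?addr_ge0// lerDr.
rewrite -[W t w](subrK (W 0 w)); apply: le_trans (ler_normD _ _) _.
have : 0 <= `|W 0 w| * `|t| by exact: mulr_ge0.
lra.
Qed.

Theorem theorem3 (R : realType) (d : measure_display) (T : measurableType d)
    (P : probability T R) (W : R -> {RV P >-> R})
    (hW : two_sided_brownian_motion W) :
  {ae P, forall w : T, forall r1 r2 : R -> R,
    characterization (fun t : R => W t w - 4 * t ^+ 3) r1 ->
    characterization (fun t : R => W t w - 4 * t ^+ 3) r2 ->
    r1 = r2}.
Proof.
apply: filterS2 (bm_continuous_paths hW) (ae_path_growth hW) => w cw /(_ cw)[C C1 WC] r1 r2.
exact: pathwise_uniqueness cw C1 WC.
Qed.
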